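(* Let $\mu>0$ and let $m,n\ge 1$ be integers. Let $N=m+2n$ and define $N\times N$ real matrices $D^{(m-1,n)}$ and $E^{(m,n-1)}$ by $$D^{(m-1,n)}_{i,j}=\begin{cases}0 & j=1,\\ \dfrac{m}{i\mu} & i=j>1,\\[4pt] \dfrac{m}{2\mu^2} & j=i+1,\\[4pt] m\,\dfrac{(i+1)\cdots(j-1)}{2^{j-i}\mu^{j-i+1}} & j>i+1,\\ 0&\text{otherwise},\end{cases}\qquad E^{(m,n-1)}_{i,j}=\begin{cases}0 & j=1,2,\\ \dfrac{n}{i\mu} & i=j>2,\\[4pt] \dfrac{n}{2\mu^2} & j=i+1,\ j>2,\\[4pt] n\,\dfrac{(i+1)\cdots(j-1)}{2^{j-i}\mu^{j-i+1}} & j>i+1,\ j>2,\\ 0&\text{otherwise}.\end{cases}$$ Then the coefficient vectors of the polynomials $V_{m,n},V_{m-1,n},V_{m,n-1}$ satisfy $$\underline a_{m,n}=D^{(m-1,n)}\begin{pmatrix}0\\ \underline a_{m-1,n}\end{pmatrix}+E^{(m,n-1)}\begin{pmatrix}0\\0\\ \underline a_{m,n-1}\end{pmatrix}.$$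
   Context: Let $B_t$ be a standard one-dimensional Brownian motion ($B_0=0$). For $x>0$ and $\mu>0$ let $X(t)=x-\mu t+B_t$, $\tau(x)=\inf\{t>0: X(t)\le 0\}$ (finite almost surely) and $A(x)=\int_0^{\tau(x)}X(t)\,dt$. For integers $m,n\ge0$ not both zero, $V_{m,n}(x)=E[\tau(x)^mA(x)^n]$ is a polynomial in $x$ of degree $m+2n$ with zero constant term; write $V_{m,n}(x)=\sum_{k=1}^{m+2n}a_k^{(m,n)}x^k$ and $\underline a_{m,n}=(a_1^{(m,n)},\dots,a_{m+2n}^{(m,n)})^T\in\mathbb R^{m+2n}$. Thus $\underline a_{m-1,n}\in\mathbb R^{m+2n-1}$ and $\underline a_{m,n-1}\in\mathbb R^{m+2n-2}$, and the vectors on the right-hand side of the recursion, padded with one and two leading zeros respectively, lie in $\mathbb R^{m+2n}$. *)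

(* Defs.v *)
From HB Require Import structures.
From mathcomp Require Import all_boot all_order all_algebra.
From mathcomp Require Import all_classical all_reals all_analysis.

Set Implicit Arguments.
Unset Strict Implicit.
Unset Printing Implicit Defensive.

Import Order.TTheory GRing.Theory Num.Theory.
Import numFieldNormedType.Exports.

Local Open Scope classical_set_scope.
Local Open Scope ring_scope.

(* Taking some of the [A i] to be [setT] gives the product rule for every
   subfamily. *)
Definition independent_family d (T : measurableType d) (R : realType)
    (P : probability T R) (k : nat) (Y : 'I_k -> T -> R) : Prop :=
  forall A : 'I_k -> set R, (forall i, measurable (A i)) ->
    P [set w | forall i, A i (Y i w)] = (\prod_(i < k) P (Y i @^-1` A i))%E.

(* The time index is a real number, but only times [0 <= t] are constrained.
   The second parameter of [normal_prob] is the standard deviation.  All paths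
   are continuous, so that hitting times are measurable even when the
   probability space is not complete. *)
Record standard_brownian_motion d (T : measurableType d) (R : realType)
    (P : probability T R) (B : R -> {RV P >-> R}) : Prop := {
  bm_start : forall w, B 0 w = 0;
  bm_indep_increments : forall (k : nat) (t : nat -> R),
    0 <= t 0%N -> (forall i, (i < k)%N -> t i <= t i.+1) ->
    independent_family P
      (fun (i : 'I_k) (w : T) => B (t i.+1) w - B (t i) w);
  bm_gaussian_increments : forall s t : R, 0 <= s -> s < t ->
    forall U : set R, measurable U ->
    P [set w | U (B t w - B s w)] = normal_prob 0 (Num.sqrt (t - s)) U;
  bm_continuous : forall w, {within `[0, +oo[, continuous (fun t => B t w)}
}.

Section FirstPassage.
Context d (T : measurableType d) (R : realType) (P : probability T R).
Variables (B : R -> {RV P >-> R}) (mu : R).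

Definition drifted (x t : R) (w : T) : R := x - mu * t + B t w.

(* Extended-real valued: [+oo] on the (null) event that the path stays
   positive. *)
Definition hitting_time (x : R) (w : T) : \bar R :=
  ereal_inf [set t%:E | t in [set t : R | 0 < t /\ drifted x t w <= 0]].

Definition hitting_area (x : R) (w : T) : \bar R :=
  (\int[lebesgue_measure]_(t in [set t : R | (0 <= t)%R /\
     (t%:E <= hitting_time x w)%E]) (drifted x t w)%:E)%E.

(* Written as an integral because ['E_P] only accepts real-valued variables. *)
Definition joint_moment (m n : nat) (x : R) : \bar R :=
  (\int[P]_w (hitting_time x w ^+ m * hitting_area x w ^+ n))%E.

End FirstPassage.

Section RecursionMatrices.
Variable R : realType.

(* Ordinals start at 0; [i] and [j] below are the usual 1-based indices. *)
Definition Dmx (N m : nat) (mu : R) : 'M[R]_N :=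
  \matrix_(r < N, c < N)
    let i := r.+1 in let j := c.+1 in
    if j == 1%N then 0
    else if i == j then m%:R / (i%:R * mu)
    else if j == i.+1 then m%:R / (2 * mu ^+ 2)
    else if (i.+1 < j)%N then
      m%:R * ((\prod_(i.+1 <= l < j) l%:R)
              / (2 ^+ (j - i) * mu ^+ (j - i + 1)))
    else 0.

Definition Emx (N n : nat) (mu : R) : 'M[R]_N :=
  \matrix_(r < N, c < N)
    let i := r.+1 in let j := c.+1 in
    if (j == 1%N) || (j == 2%N) then 0
    else if i == j then n%:R / (i%:R * mu)
    else if j == i.+1 then n%:R / (2 * mu ^+ 2)
    else if (i.+1 < j)%N then
      n%:R * ((\prod_(i.+1 <= l < j) l%:R)
              / (2 ^+ (j - i) * mu ^+ (j - i + 1)))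
    else 0.

Definition pad_top (q k N : nat) (e : (q + k)%N = N) (v : 'cV[R]_k) :
  'cV[R]_N := castmx (e, erefl 1%N) (col_mx (0 : 'cV[R]_q) v).

End RecursionMatrices.

Lemma dim_pad1 (m n : nat) :
  (0 < m)%N -> (1 + (m.-1 + 2 * n))%N = (m + 2 * n)%N.
Proof. by case: m. Qed.

Lemma dim_pad2 (m n : nat) :
  (0 < n)%N -> (2 + (m + 2 * n.-1))%N = (m + 2 * n)%N.
Proof. by case: n => // n _; rewrite mulnS addnCA. Qed.

(* Main.v *)
Require Import Defs.
From HB Require Import structures.
From mathcomp Require Import all_boot all_order all_algebra.
From mathcomp Require Import all_classical all_reals all_analysis.
From mathcomp Require Import measurable_realfun.
From mathcomp Require Import ring lra zify.

Set Implicit Arguments.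
Unset Strict Implicit.
Unset Printing Implicit Defensive.

Import Order.TTheory GRing.Theory Num.Theory.
Import numFieldNormedType.Exports.

Local Open Scope classical_set_scope.
Local Open Scope ring_scope.


(* Fix [x > 0] and a small time [h = r^2].  Off an event of probability
   [O(h^4)] the drifted path stays within [e] of [x] up to time [h], so that
   [tau = h + tau'] and [h (x - e) + A' <= A <= h (x + e) + A'] with
   [tau'], [A'] the passage time and area of the path restarted at time [h].
   Expanding [(h + tau')^m (h (x -+ e) + A')^n] to first order in [h], applying
   the Markov property at time [h] and Taylor-expanding the resulting Gaussian
   expectations of the polynomials [V_{p,q}] gives, as [h] and then [e] tend
   to [0],
     V_{m,n}''(x) / 2 - mu V_{m,n}'(x) + m V_{m-1,n}(x) + n x V_{m,n-1}(x) = 0.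
   This polynomial identity is a bidiagonal linear system for the coefficients
   of [V_{m,n}], and the matrices [D] and [E] are its explicit solution. *)

(** * Passage time and area of a path *)

Section HalfLinePath.
Context {R : realType}.
Implicit Types f : R -> R.

(** The process is cut only at one deterministic time, so independence, stationarity and continuity
    suffice and no stopping-time argument is needed. The Markov property is an equality of laws on
    the space of continuous paths, which is why passage time and area must be measurable functions
    of the path. [ha] is used for many exponents at once: (1, 0) and (0, 1) make tau and A finite
    almost surely, while (2m, 0), (0, 2n) and (2m, 2n) control the errors. The expansion variable is
    r, not h, because the increment of B over time r^2 is r times a standard normal variable. All
    errors are O(r^3), and division by r^2 leaves O(r). A path restarted at or below 0 has no moment
    given by V. The functionals are set to 0 there, and the cut-off is harmless since it forces a
    displacement of at least x. On the exceptional oscillation event only second moments are known,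
    so its probability must be much smaller than h^2; this is why chaining uses eighth moments. *)

Definition first_passage f : \bar R :=
  ereal_inf [set t%:E | t in [set t : R | 0 < t /\ f t <= 0]].

Definition passage_area f : \bar R :=
  (\int[lebesgue_measure]_(t in [set t : R | (0 <= t)%R /\
     (t%:E <= first_passage f)%E]) (f t)%:E)%E.

Lemma within_continuous_dist f (A : set R) t : {within A, continuous f} ->
  A t -> forall e, 0 < e -> exists2 d, 0 < d &
    forall s, A s -> `|s - t| < d -> `|f s - f t| < e.
Proof.
move=> /subspace_continuousP cf At e e0.
have /cvgrPdist_lt/(_ _ e0) := cf t At.
rewrite near_withinE => /nbhs_ballP[d /= d0 dP].
exists d => // s As st; rewrite distrC; apply: dP => //.
by rewrite /ball/= distrC.
Qed.

Lemma first_passage_le f t : 0 < t -> f t <= 0 -> (first_passage f <= t%:E)%E.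
Proof. by move=> t0 ft; apply: ereal_inf_lbound; exists t. Qed.

Lemma first_passage_ge f (r : R) : (forall t, 0 < t -> t < r -> 0 < f t) ->
  (r%:E <= first_passage f)%E.
Proof.
move=> fP; apply: le_ereal_inf_tmp => _ [t [t0 ft] <-]; rewrite lee_fin leNgt.
by apply/negP => tr; have := fP t t0 tr; rewrite ltNge ft.
Qed.

Lemma first_passage_ge0 f : (0 <= first_passage f)%E.
Proof. by apply: first_passage_ge => t t0 /lt_trans-/(_ _ t0); rewrite ltxx. Qed.

Lemma gt0_before_passage f t : 0 < f 0 -> 0 <= t ->
  (t%:E < first_passage f)%E -> 0 < f t.
Proof.
move=> f0; rewrite le_eqVlt => /predU1P[<-//|t0].
by rewrite ltNge => tf; rewrite ltNge; apply: contra tf; exact: first_passage_le.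
Qed.

(** Before the passage time the path is strictly positive. At the passage time itself continuity
    from the left keeps it nonnegative: a negative value would spread to an earlier positive
    time. *)
Lemma ge0_until_passage f t : {within `[0, +oo[, continuous f} -> 0 < f 0 ->
  0 <= t -> (t%:E <= first_passage f)%E -> 0 <= f t.
Proof.
move=> cf f0; rewrite le_eqVlt => /predU1P[<- _|t0 tf]; first exact: ltW.
rewrite leNgt; apply/negP => ft0.
have At : `[0, +oo[%classic t by rewrite /= in_itv/= andbT ltW.
have [|d d0 dP] := within_continuous_dist cf At (e := - f t); first by rewrite oppr_gt0.
pose s := Num.max (t / 2) (t - d / 2).
have s0 : 0 < s by rewrite lt_max divr_gt0.
have st : s < t by rewrite gt_max; apply/andP; split; lra.
have std : `|s - t| < d.
  rewrite ltr0_norm ?subr_lt0// opprB.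
  have : t - d / 2 <= s by rewrite le_max lexx orbT.
  lra.
have := dP s _ std; rewrite /= in_itv/= andbT ltW// => /(_ isT).
rewrite ltr_norml => /andP[_ fs].
have : (first_passage f <= s%:E)%E by apply: first_passage_le => //; lra.
by move=> /(le_trans tf); rewrite lee_fin leNgt st.
Qed.

(** By compactness a path positive on [0, r] has a positive minimum there; conversely a lower bound
    at rational times extends by density and continuity. Only countably many coordinates occur,
    which makes the passage time measurable. *)
Lemma lt_first_passageP f r : {within `[0, +oo[, continuous f} -> 0 < f 0 ->
  0 <= r -> (r%:E < first_passage f)%E <->
  exists k : nat, forall q : rat, 0 <= (ratr q : R) <= r -> k.+1%:R^-1 <= f (ratr q).
Proof.
move=> cf f0 r0; split=> [rf|[k kP]].
  have cfr : {within `[0, r], continuous f}.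
    by apply: continuous_subspaceW cf => x /=; rewrite !in_itv/= => /andP[->].
  have [c cr cP] := EVT_min r0 cfr.
  have fc0 : 0 < f c.
    move: cr; rewrite in_itv/= => /andP[c0 cr].
    by apply: gt0_before_passage => //; apply: le_lt_trans rf; rewrite lee_fin.
  exists (Num.truncn (f c)^-1) => q qr; apply: le_trans (cP (ratr q) _).
    rewrite -[leRHS]invrK lef_pV2 ?posrE ?invr_gt0//.
    by apply/ltW; exact: truncnS_gt.
  by rewrite in_itv/=.
set c : R := k.+1%:R^-1 in kP.
have c0 : 0 < c by rewrite invr_gt0.
have fc t : 0 <= t <= r -> c <= f t.
  move=> /andP[t0 tr]; rewrite leNgt; apply/negP => ftc.
  have At : `[0, +oo[%classic t by rewrite /= in_itv/= andbT.
  have [|d d0 dP] := within_continuous_dist cf At (e := c - f t).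
    by rewrite subr_gt0.
  suff [q qr qd] : exists2 q : rat, 0 <= (ratr q : R) <= r & `|ratr q - t| < d.
    have /andP[q0 _] := qr.
    have := dP (ratr q) _ qd; rewrite /= in_itv/= andbT => /(_ q0).
    by rewrite ltr_norml => /andP[_]; have := kP q qr; lra.
  move: r0; rewrite le_eqVlt => /predU1P[r0|r0].
    exists 0; rewrite rmorph0; first by rewrite -r0 lexx.
    have -> : t = 0 by apply/eqP; rewrite eq_le t0 r0 tr.
    by rewrite subrr normr0.
  have : Num.max 0 (t - d) < Num.min r (t + d).
    rewrite lt_min !gt_max r0/=. apply/andP; split; [|apply/andP; split]; lra.
  move=> /rat_in_itvoo[q]; rewrite in_itv/= lt_min gt_max.
  move=> /andP[/andP[q0 q1] /andP[q2 q3]]; exists q; first by rewrite !ltW.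
  by rewrite ltr_norml; apply/andP; split; lra.
have Ar : `[0, +oo[%classic r by rewrite /= in_itv/= andbT.
have [d d0 dP] := within_continuous_dist cf Ar c0.
have rd : r < r + d by rewrite ltrDl.
apply: (@lt_le_trans _ _ (r + d)%:E); first by rewrite lte_fin.
apply: first_passage_ge => t t0 trd.
have [tr|rt] := leP t r; first by rewrite (lt_le_trans c0)// fc// ltW.
have /dP : `[0, +oo[%classic t by rewrite /= in_itv/= andbT ltW.
rewrite ger0_norm; last by rewrite subr_ge0 ltW.
move=> /(_ _); rewrite ltrBlDl => /(_ trd).
by have := fc r; rewrite r0 lexx => /(_ isT) frc; rewrite ltr_norml => /andP[+ _]; lra.
Qed.

End HalfLinePath.

(** * Cutting a path at a fixed time *)

Section TimeShift.
Context {R : realType}.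
Implicit Types (f : R -> R) (h : R).
Notation mu := (@lebesgue_measure R).

Lemma lebesgue_measureD h (A : set R) : measurable A ->
  pushforward mu (fun t : measurableTypeR R => (h + t : measurableTypeR R)) A = mu A.
Proof.
move=> mA; apply/esym/lebesgue_measure_unique => //.
  exact: measurable_funD.
move=> mh _ [[a b]] _ <- /=.
rewrite /pushforward.
rewrite (_ : _ @^-1` _ = `](a - h), (b - h)]%classic); last first.
  by apply/seteqP; split=> t /=; rewrite !in_itv/= ltrBlDl lerBrDl.
rewrite !lebesgue_measure_itv/= !lte_fin ltrD2r.
by case: ifPn => // _; rewrite -!EFinB; congr (_%:E); lra.
Qed.

Lemma within_continuous_shift f h : 0 <= h -> {within `[0, +oo[, continuous f} ->
  {within `[0, +oo[, continuous (fun s => f (h + s))}.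
Proof.
move=> h0 cf; apply/subspace_continuousP => s s0.
apply/cvgrPdist_lt => e e0.
have hs0 : `[0, +oo[%classic (h + s).
  by move: s0; rewrite /= !in_itv/= !andbT => s0; rewrite addr_ge0.
have [d d0 dP] := within_continuous_dist cf hs0 e0.
rewrite near_withinE; apply/nbhs_ballP; exists d => //= t /= + t0.
rewrite /ball/= distrC => ts; rewrite distrC; apply: dP.
  by move: t0; rewrite /= !in_itv/= !andbT => t0; rewrite addr_ge0.
by rewrite opprD addrACA subrr add0r.
Qed.

Lemma first_passage_shift f h : 0 <= h -> (forall t, 0 <= t <= h -> 0 < f t) ->
  first_passage f = (h%:E + first_passage (fun s => f (h + s)%R))%E.
Proof.
move=> h0 fh; apply/eqP; rewrite eq_le; apply/andP; split.
  rewrite -leeBlDl//; apply: le_ereal_inf_tmp => _ [t [t0 ft] <-].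
  rewrite leeBlDl// -EFinD; apply: first_passage_le => //.
  by rewrite ltr_wpDl.
apply: le_ereal_inf_tmp => _ [t [t0 ft] <-].
have ht : h < t.
  rewrite ltNge; apply: contraTN isT => th.
  by have := fh t; rewrite th ltW// ltNge ft => /(_ isT).
have -> : t%:E = (h%:E + (t - h)%:E)%E by rewrite -EFinD subrKC.
by rewrite leeD2l// first_passage_le// ?subr_gt0// subrKC.
Qed.

Lemma measurable_until (x : \bar R) : measurable [set t : R | 0 <= t /\ (t%:E <= x)%E].
Proof.
rewrite (_ : [set t : R | _] = `[0, +oo[%classic `&` (EFin @^-1` `]-oo, x]%classic)).
  apply: measurableI => //; rewrite -[X in measurable X]setTI.
  by apply: EFin_measurable => //; exact: emeasurable_itv.
by apply/seteqP; split=> t /=; rewrite !in_itv/= andbT.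
Qed.

Lemma within_continuous_measurable f (A : set R) : {within `[0, +oo[, continuous f} ->
  measurable A -> A `<=` `[0, +oo[ -> measurable_fun A f.
Proof.
move=> cf mA A0; apply: (measurable_funS _ A0) => //.
exact: subspace_continuous_measurable_fun.
Qed.

Lemma passage_area_shift f h : 0 <= h -> {within `[0, +oo[, continuous f} ->
  (forall t, 0 <= t <= h -> 0 < f t) ->
  passage_area f = (\int[mu]_(t in `[0%R, h[) (f t)%:E +
    passage_area (fun s => f (h + s)%R))%E.
Proof.
move=> h0 cf fh; set g := fun s => f (h + s).
have cg : {within `[0, +oo[, continuous g} by exact: within_continuous_shift.
have tauE : first_passage f = (h%:E + first_passage g)%E by exact: first_passage_shift.
have f0 : 0 < f 0 by apply: fh; rewrite lexx.
have g0 : 0 < g 0 by apply: fh; rewrite addr0 h0/=.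
pose D := [set t : R | h <= t /\ (t%:E <= first_passage f)%E].
have D0 : D `<=` `[0, +oo[.
  by move=> t [ht _]; rewrite /= in_itv/= andbT (le_trans h0).
have mD : measurable D.
  rewrite (_ : D = `[h, +oo[%classic `&` [set t : R | 0 <= t /\ (t%:E <= first_passage f)%E]).
    by apply: measurableI => //; exact: measurable_until.
  apply/seteqP; split=> t /=; rewrite in_itv/= andbT => -[ht]; first by rewrite (le_trans h0 ht).
  by case.
have hf : (h%:E <= first_passage f)%E by rewrite tauE leeDl// first_passage_ge0.
rewrite /passage_area.
rewrite (_ : [set t : R | _] = `[0, h[ `|` D); last first.
  apply/seteqP; split=> t /=; rewrite /D/= in_itv/=.
    by move=> [t0 tf]; case: (ltP t h) => th; [left; rewrite t0|right].
  move=> [/andP[t0 th]|[ht tf]]; last by rewrite (le_trans h0).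
  by rewrite t0; split=> //; apply: le_trans hf; rewrite lee_fin ltW.
have itv0 : `[0, h[%classic `<=` `[0, +oo[%classic.
  by move=> t /=; rewrite !in_itv/= => /andP[->].
rewrite (@ge0_integral_setU _ _ _ mu `[0, h[%classic D)//=; last 3 first.
- apply/measurable_EFinP; apply: (within_continuous_measurable cf).
    exact: measurableU.
  by rewrite subUset.
- move=> t; rewrite lee_fin in_itv/= => -[/andP[t0 th]|[ht tf]].
    by apply/ltW/fh; rewrite t0 ltW.
  by apply: ge0_until_passage => //; rewrite (le_trans h0).
- rewrite disj_set2E; apply/eqP/seteqP; split=> t //= -[]; rewrite in_itv/=.
  by move=> /andP[_ th] [ht _]; move: th; rewrite ltNge ht.
congr (_ + _)%E.
(* Translation invariance replaces Lebesgue measure by its image under [phi]; the substitution t ->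
   h + t is then the push-forward formula. *)
pose phi := fun t : measurableTypeR R => (h + t : measurableTypeR R).
have mphi : measurable_fun setT phi by exact: measurable_funD.
transitivity (\int[pushforward mu phi]_(t in D) (f t)%:E)%E.
  by apply: eq_measure_integral => // A mA _; apply/esym; exact: lebesgue_measureD.
rewrite ge0_integral_pushforward//=.
- have -> // : phi @^-1` D = [set t : R | 0 <= t /\ (t%:E <= first_passage g)%E].
  by apply/seteqP; split=> t; rewrite /D/phi/= lerDl tauE EFinD leeD2lE.
- by apply/measurable_EFinP; apply: (within_continuous_measurable cf).
- move=> t; rewrite inE => -[ht tf]; rewrite lee_fin.
  by apply: ge0_until_passage => //; rewrite (le_trans h0).
Qed.

End TimeShift.

(** * The space of continuous paths *)

Section CoordinateLaw.
Context {R : realType} (E : pointedType) (I : choiceType) (c : I -> E -> R).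

(** Kept generic in the index because two instances occur: sequences of increments, indexed by
    [nat], and paths, indexed by nonnegative times. *)
Definition coord_sets : set (set E) :=
  [set S | exists i, exists2 U : set R, measurable U & S = c i @^-1` U].

Lemma measurable_coord i :
  measurable_fun setT (c i : g_sigma_algebraType coord_sets -> R).
Proof.
move=> _ U mU; rewrite setTI; apply: sub_sigma_algebra.
by exists i, U.
Qed.

Lemma measurable_into_coord d (O : measurableType d)
    (phi : O -> g_sigma_algebraType coord_sets) :
  (forall i, measurable_fun setT (c i \o phi)) -> measurable_fun setT phi.
Proof.
move=> mphi; apply: (measurability (coord_sets : set (set (g_sigma_algebraType coord_sets)))) => //.
move=> _ [_ [i [U mU ->]] <-].
exact: mphi.
Qed.

(** Finite-dimensional cylinders form a generating pi-system. Closure under intersection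
    concatenates index lists and may repeat an index; [undup] restores the uniqueness that the
    hypothesis asks for. *)
Lemma coord_law_unique (m1 m2 : {measure set (g_sigma_algebraType coord_sets) -> \bar R}) :
  (m1 setT < +oo)%E ->
  (forall s : seq I, uniq s -> forall A : I -> set R, (forall i, measurable (A i)) ->
     m1 [set f | forall i, i \in s -> A i (c i f)] =
     m2 [set f | forall i, i \in s -> A i (c i f)]) ->
  forall S, measurable S -> m1 S = m2 S.
Proof.
move=> m1oo m12 S mS.
pose G : set (set E) := [set S | exists s : seq I, exists2 A : I -> set R,
  (forall i, measurable (A i)) & S = [set f | forall i, i \in s -> A i (c i f)]].
have mG : G `<=` (measurable : set (set (g_sigma_algebraType coord_sets))).
  move=> _ [s [A mA ->]].
  rewrite (_ : [set f | _] = \big[setI/setT]_(i <- s) (c i @^-1` A i)); last first.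
    by rewrite -bigcap_seq; apply/seteqP; split=> f /=.
  apply: bigsetI_measurable => i _; rewrite -[X in measurable X]setTI.
  exact: measurable_coord.
apply: (@g_sigma_algebra_measure_unique _ R (g_sigma_algebraType coord_sets) G mG (fun=> setT)) => //.
- by move=> _; exists [::], (fun=> setT) => //; apply/seteqP; split=> f.
- by rewrite bigcup_const//; exists 0%N.
- move=> _ _ [s1 [A1 mA1 ->]] [s2 [A2 mA2 ->]].
  exists (s1 ++ s2), (fun i => (if i \in s1 then A1 i else setT) `&`
                               (if i \in s2 then A2 i else setT)).
    by move=> i; apply: measurableI; case: ifP.
  apply/seteqP; split=> f /=.
    by move=> [f1 f2] i _; split; case: ifP => // ?; [exact: f1|exact: f2].
  move=> f12; split=> i iS.
    by have := f12 i; rewrite mem_cat iS => /(_ isT)[].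
  by have := f12 i; rewrite mem_cat iS orbT => /(_ isT)[].
- move=> _ [s [A mA ->]].
  have -> : [set f | forall i, i \in s -> A i (c i f)] =
            [set f | forall i, i \in undup s -> A i (c i f)].
    by apply/seteqP; split=> f /= fs i; have := fs i; rewrite mem_undup.
  by apply: m12 => //; exact: undup_uniq.
- move: S mS; apply: sub_sigma_algebra2 => _ [i [U mU ->]].
  exists [:: i], (fun=> U) => //.
  apply/seteqP; split=> f /=; first by move=> fU j; rewrite inE => /eqP ->.
  by apply; rewrite inE.
Qed.

End CoordinateLaw.

Section PathSpace.
Variable R : realType.

Definition halfline_path := {f : R -> R | {within `[0, +oo[, continuous f}}.

Lemma within_continuous_cst0 : {within `[0, +oo[, continuous (cst 0 : R -> R)}.
Proof. by apply: continuous_subspaceT => x; exact: cvg_cst. Qed.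

HB.instance Definition _ := gen_eqMixin halfline_path.
HB.instance Definition _ := gen_choiceMixin halfline_path.
HB.instance Definition _ := isPointed.Build halfline_path
  (exist (fun f : R -> R => {within `[0, +oo[, continuous f}) _ within_continuous_cst0).

(** Only nonnegative times are coordinates: at negative times neither the continuity nor the law of
    the process is constrained. *)
Definition path_at (t : {nonneg R}) (f : halfline_path) : R := sval f t%:num.

Definition path_space := g_sigma_algebraType (coord_sets path_at).

HB.instance Definition _ := Measurable.on path_space.

End PathSpace.

(** * Measurability of passage time and area *)

Section PassageMeasurability.
Context {R : realType}.
Notation E := (path_space R).
Notation mu := (@lebesgue_measure R).

Definition positive_start : set E := [set f | 0 < sval f 0].

Lemma measurable_path_at (t : R) : 0 <= t -> measurable_fun setT (fun f : E => sval f t).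
Proof.
move=> t0; exact (@measurable_coord R (halfline_path R) _ (@path_at R) (NngNum t0)).
Qed.

Lemma measurable_path_at_ge (t e : R) : 0 <= t -> measurable [set f : E | e <= sval f t].
Proof.
move=> t0; rewrite (_ : [set f | _] = setT `&` (fun f : E => sval f t) @^-1` `[e, +oo[).
  exact: measurable_path_at.
by rewrite setTI; apply/seteqP; split=> f /=; rewrite in_itv/= andbT.
Qed.

Lemma measurable_positive_start : measurable positive_start.
Proof.
rewrite (_ : positive_start = setT `&` (fun f : E => sval f 0) @^-1` `]0, +oo[).
  exact: measurable_path_at.
by rewrite setTI; apply/seteqP; split=> f /=; rewrite in_itv/= andbT.
Qed.

(** [lt_first_passageP] writes each event [r < first_passage] as a countable union of countable
    intersections of coordinate events. It needs [0 < f 0], hence the domain [positive_start]. *)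
Lemma measurable_first_passage :
  measurable_fun positive_start (fun f : E => first_passage (sval f)).
Proof.
move=> mD; apply: (measurability _ (ErealGenOInfty.measurableE R)) => //.
move=> _ [_ [r ->] <-].
have [r0|r0] := ltP r 0.
  rewrite (_ : _ `&` _ = positive_start) //; apply/seteqP; split=> f /=; first by case.
  move=> f0; split=> //; rewrite in_itv/= andbT.
  by apply: lt_le_trans (first_passage_ge0 _); rewrite lte_fin.
rewrite (_ : _ `&` _ = positive_start `&` \bigcup_(k : nat) ~` \bigcup_(q : rat)
    ~` [set f : E | 0 <= (ratr q : R) <= r -> k.+1%:R^-1 <= sval f (ratr q)]).
  apply: measurableI => //; apply: bigcupT_measurable => k.
  apply: measurableC; apply: bigcupT_measurable_rat => q; apply: measurableC.
  have [/andP[q0 qr]|nq] := boolP (0 <= (ratr q : R) <= r).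
    rewrite (_ : [set f | _] = [set f : E | k.+1%:R^-1 <= sval f (ratr q)]).
      exact: measurable_path_at_ge.
    by apply/seteqP; split=> f /=; [apply|].
  by rewrite (_ : [set f | _] = setT)//; apply/seteqP; split=> f.
apply/seteqP; split=> f /= [f0]; rewrite in_itv/= andbT.
  move=> /(lt_first_passageP (svalP f) f0 r0)[k kP]; split=> //.
  by exists k => // -[q _]; apply; exact: kP.
move=> [k _ kP]; split=> //; apply/(lt_first_passageP (svalP f) f0 r0); exists k => q qr.
by apply: contrapT => nq; apply: kP; exists q => // h; apply: nq; exact: h.
Qed.

Lemma cvg_grid_approx (t : R) : 0 <= t ->
  (Num.truncn (n.+1%:R * t))%:R / n.+1%:R @[n --> \oo] --> t.
Proof.
move=> t0; apply/cvgrPdist_le => e e0; near=> n.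
have n0 : 0 < n.+1%:R :> R by [].
have /andP[h1 h2] := truncn_itv (mulr_ge0 (ltW n0) t0).
rewrite ler_norml; apply/andP; split.
  rewrite (@le_trans _ _ 0)//; first by rewrite oppr_le0 ltW.
  by rewrite subr_ge0 ler_pdivrMr// [t * _]mulrC.
apply: (@le_trans _ _ n.+1%:R^-1).
  by rewrite lerBlDr -{1}(mul1r _^-1) -mulrDl ler_pdivlMr// [t * _]mulrC addrC natr1 ltW.
by apply/ltW; near: n; exact: (near_infty_natSinv_lt (PosNum e0)).
Unshelve. all: by end_near. Qed.

(** Joint measurability in path and time comes from a pointwise limit: at step n the time is rounded
    down to a grid of mesh 1/(n+1), so only countably many coordinates are read. *)
Lemma measurable_path_eval :
  measurable_fun setT (fun p : E * R => sval p.1 (Num.max p.2 0)).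
Proof.
pose F n (p : E * R) := sval p.1 ((Num.truncn (n.+1%:R * p.2))%:R / n.+1%:R).
apply: (measurable_fun_cvg (h := F)) => [n|[f t] _].
  move=> _ U mU; rewrite setTI.
  rewrite (_ : _ @^-1` _ = \bigcup_(j : nat)
    ((fun f : E => sval f (j%:R / n.+1%:R)) @^-1` U `*`
     (fun t : R => (Num.truncn (n.+1%:R * t))%:R : R) @^-1` [set j%:R])).
    apply: bigcupT_measurable => j; apply: measurableX.
      by rewrite -[X in measurable X]setTI; exact: measurable_path_at.
    rewrite -[X in measurable X]setTI; apply: nondecreasing_measurable => //.
    by move=> x y xy; rewrite ler_nat; apply: le_truncn; rewrite ler_wpM2l.
  apply/seteqP; split=> -[f t] /=; rewrite /F/=.
    by move=> Uf; exists (Num.truncn (n.+1%:R * t)).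
  move=> [j _ [/= Uf /eqP]]; rewrite eqr_nat => /eqP tj.
  by rewrite tj.
rewrite /F/=; have m0 : 0 <= Num.max t 0 by rewrite le_max lexx orbT.
(* [truncn] is 0 on nonpositive numbers, so the grid already sends negative times to 0. *)
have -> : (fun n => sval f ((Num.truncn (n.+1%:R * t))%:R / n.+1%:R)) =
  (fun n => sval f ((Num.truncn (n.+1%:R * Num.max t 0))%:R / n.+1%:R)).
  apply/funext => n; case: (leP t 0) => // t0; rewrite mulr0 truncn0.
  rewrite (truncn0Pn _ _)// -ltNge (le_lt_trans _ ltr01)// mulr_ge0_le0//; exact: ltW.
apply/cvgrPdist_lt => e e0.
have [|d d0 dP] := within_continuous_dist (svalP f) (t := Num.max t 0) _ e0.
  by rewrite /= in_itv/= m0.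
have /cvgrPdist_lt/(_ _ d0) := cvg_grid_approx m0.
apply: filterS => n nd; rewrite distrC; apply: dP; last by rewrite distrC.
by rewrite /= in_itv/= andbT.
Qed.

(** Tonelli: the area is a section integral of a jointly measurable nonnegative function supported
    on the pairs (path, t) with t at most the passage time. [tau0] extends the passage time by 0 to
    have a total measurable function. *)
Lemma measurable_passage_area :
  measurable_fun positive_start (fun f : E => passage_area (sval f)).
Proof.
have mD := measurable_positive_start.
pose D : set (E * R) := [set p | 0 < sval p.1 0 /\ (0 <= p.2 /\
  (p.2%:E <= first_passage (sval p.1))%E)].
pose tau0 := (fun f : E => first_passage (sval f)) \_ positive_start.
have mtau0 : measurable_fun setT tau0.
  by apply/(measurable_restrictT _ mD); exact: measurable_first_passage.
have mDD : measurable D.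
  rewrite (_ : D = (positive_start `*` `[0, +oo[) `&`
     (setT `&` (fun p : E * R => (tau0 p.1 - p.2%:E)%E) @^-1` `[0%E, +oo[)).
    apply: measurableI; first exact: measurableX.
    apply: emeasurable_funB => //; [exact: measurableT_comp|by apply/measurable_EFinP|].
    exact: emeasurable_itv.
  rewrite setTI; apply/seteqP; split=> -[f t] /=; rewrite /positive_start/= !in_itv/= !andbT.
    by move=> [f0 [t0 tf]]; split=> //; rewrite EFinN sube_ge0 ?orbT// /tau0 patchE mem_set.
  by move=> [[f0 t0]]; rewrite EFinN sube_ge0 ?orbT// /tau0 patchE mem_set.
pose g := (fun p : E * R => (sval p.1 (Num.max p.2 0))%:E) \_ D.
have mg : measurable_fun setT g.
  apply/(measurable_restrictT _ mDD); apply/measurable_funTS/measurable_EFinP.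
  exact: measurable_path_eval.
have g0 p : (0 <= g p)%E.
  rewrite /g patchE; case: ifPn => //; rewrite inE => -[f0 [t0 tf]].
  rewrite lee_fin; apply: (ge0_until_passage (svalP p.1)) => //; [by rewrite le_max lexx orbT|].
  by move/max_idPl : t0 => ->.
have := measurable_fun_fubini_tonelli_F (m2 := mu) g mg g0.
move=> /(measurable_funTS (D := positive_start)); apply: eq_measurable_fun => f.
rewrite inE => f0; rewrite /fubini_F /passage_area [RHS]integral_mkcond.
apply: eq_integral => t _; rewrite /g !patchE.
case: ifPn => [/[!inE]|nD].
  by move=> [_ [t0 tf]]; rewrite mem_set//; move/max_idPl : t0 => ->.
rewrite memNset// => -[t0 tf]; move: nD; rewrite notin_setE; apply.
by split.
Qed.

End PassageMeasurability.

(** * The Markov property at a fixed time *)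

Section MarkovProperty.
Context d (T : measurableType d) (R : realType) (P : probability T R).
Variables (B : R -> {RV P >-> R}) (mu : R).
Hypothesis hB : standard_brownian_motion B.

Lemma measurable_bm_event (f : T -> R) (U : set R) :
  measurable_fun setT f -> measurable U -> measurable [set w | U (f w)].
Proof. by move=> mf mU; rewrite -[X in measurable X]setTI; exact: mf. Qed.

(** Stated through [B (t - s) - B 0] rather than a normal law, so that the degenerate case s = t is
    covered; repeated grid points do occur below. *)
Lemma bm_increment_stationary (s t : R) (U : set R) : 0 <= s -> s <= t -> measurable U ->
  P [set w | U (B t w - B s w)] = P [set w | U (B (t - s) w - B 0 w)].
Proof.
move=> s0; rewrite le_eqVlt => /predU1P[->|st] mU.
  by congr (P _); apply/seteqP; split=> w /=; rewrite !subrr.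
have ts0 : 0 < t - s by rewrite subr_gt0.
have := bm_gaussian_increments hB (lexx 0) ts0 mU; rewrite [t - s - 0]subr0 => e.
exact: etrans (bm_gaussian_increments hB s0 st mU) (esym e).
Qed.

Lemma bm_increment_cylinder (k : nat) (t : nat -> R) (A : nat -> set R) :
  0 <= t 0%N -> (forall i, t i <= t i.+1) -> (forall i, measurable (A i)) ->
  P [set w | forall i, (i < k)%N -> A i (B (t i.+1) w - B (t i) w)] =
  (\prod_(i < k) P [set w | A i (B (t i.+1 - t i) w - B 0 w)%R])%E.
Proof.
move=> t0 tS mA.
have ti i : 0 <= t i by elim: i => // i /le_trans; apply.
have := bm_indep_increments hB t0 (fun i _ => tS i) (A := fun i : 'I_k => A i) (fun i => mA i).
rewrite (_ : [set w | _] = [set w | forall i, (i < k)%N -> A i (B (t i.+1) w - B (t i) w)]).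
  move=> ->; apply: eq_bigr => i _; exact: bm_increment_stationary.
apply/seteqP; split=> w /= wA i; first by move=> ik; exact: (wA (Ordinal ik)).
exact: wA.
Qed.

Section SequenceLaw.
Variables (h : R) (s : nat -> R).
Hypotheses (h0 : 0 <= h) (s0 : s 0%N = 0) (sS : forall i, s i <= s i.+1).

Notation E := (g_sigma_algebraType (coord_sets (fun (i : nat) (e : nat -> R) => e i))).

(** The first step runs from 0 to h, so that the increments of index 1, 2, ... are those of the path
    after h along the grid [s]. *)
Definition shifted_grid (i : nat) : R := if i is j.+1 then h + s j else 0.

Definition grid_increments (w : T) : E :=
  fun i => B (shifted_grid i.+1) w - B (shifted_grid i) w.

Definition split_increments (p : T * T) : E :=
  fun i => if i is j.+1 then B (s j.+1) p.2 - B (s j) p.2 else B h p.1 - B 0 p.1.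

Lemma measurable_grid_increments : measurable_fun setT grid_increments.
Proof.
apply: (@measurable_into_coord R (nat -> R) _ (fun i e => e i)) => i.
exact: measurable_funB.
Qed.

Lemma measurable_split_increments : measurable_fun setT split_increments.
Proof.
apply: (@measurable_into_coord R (nat -> R) _ (fun i e => e i)) => -[|i].
  by apply: measurable_funB; exact: measurableT_comp.
by apply: measurable_funB; exact: measurableT_comp.
Qed.

(** On cylinders independence factorises both sides, and stationarity removes h from the later
    increments. The product measure supplies two independent copies: one runs up to h, the other
    starts afresh. *)
Lemma increments_law (S : set E) : measurable S ->
  P (grid_increments @^-1` S) = (P \x P)%E (split_increments @^-1` S).
Proof.
have mg := measurable_grid_increments; have ms := measurable_split_increments.
move: S; change (forall S : set E, measurable S ->
  pushforward P grid_increments S = pushforward (P \x P)%E split_increments S).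
apply: coord_law_unique.
  by rewrite -[ltLHS]/(P (grid_increments @^-1` setT)) preimage_setT probability_setT ltry.
move=> l _ A mA; rewrite /= /pushforward.
(* Unconstrained indices get [setT], so the cylinder becomes a condition on all i < k. *)
pose A' i := if i \in l then A i else setT.
have mA' i : measurable (A' i) by rewrite /A'; case: ifP.
pose k := (\max_(i <- l) i).+1.
have lk i : i \in l -> (i < k)%N by move=> il; rewrite ltnS; exact: leq_bigmax_seq.
have -> : [set f : nat -> R | forall i, i \in l -> A i (f i)] =
          [set f | forall i, (i < k)%N -> A' i (f i)].
  apply/seteqP; split=> f /= fA i; first by move=> _; rewrite /A'; case: ifPn => // /fA.
  by move=> il; have := fA i (lk i il); rewrite /A' il.
have t0 i : 0 <= shifted_grid i.
  case: i => //= i; rewrite addr_ge0//; elim: i => [|i /le_trans]; first by rewrite s0.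
  exact.
have tS i : shifted_grid i <= shifted_grid i.+1.
  by case: i => [|i]; rewrite /= ?s0 ?addr0// lerD2l.
have := bm_increment_cylinder k (lexx 0) tS mA'; rewrite /= => ->.
rewrite (_ : split_increments @^-1` _ =
   [set w | A' 0%N (B h w - B 0 w)] `*`
   [set w | forall i, (i < k.-1)%N -> A' i.+1 (B (s i.+1) w - B (s i) w)]).
  rewrite product_measure1E.
  - rewrite /k big_ord_recl/= s0 addr0 subr0; congr (_ * _)%E.
    have s00 : 0 <= s 0%N by rewrite s0.
    apply: etrans (esym (bm_increment_cylinder _ s00 sS (fun i => mA' i.+1))).
    by apply: eq_bigr => i _; rewrite opprD addrACA subrr add0r.
  - by apply: measurable_bm_event => //; exact: measurable_funB.
  - rewrite (_ : [set w | _] = \bigcap_(i in `I_k.-1)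
      [set w | A' i.+1 (B (s i.+1) w - B (s i) w)]); last by [].
    apply: bigcap_measurableType => i _.
    by apply: measurable_bm_event => //; exact: measurable_funB.
apply/seteqP; split=> -[w w'] /=.
  by move=> wA; split=> [|i ik]; [exact: (wA 0%N)|exact: (wA i.+1)].
by move=> [w0 wS] [|i] // ik; exact: wS.
Qed.

End SequenceLaw.

Lemma continuous_drifted (x : R) (w : T) :
  {within `[0, +oo[, continuous (fun t => drifted B mu x t w)}.
Proof.
apply: (@within_continuousD _ _ _ _ (fun t => x - mu * t) (fun t => B t w)).
  apply: continuous_subspaceT => t; apply: cvgB; first exact: cvg_cst.
  by apply: cvgM; [exact: cvg_cst|exact: cvg_id].
exact: bm_continuous.
Qed.

Definition drifted_path (x : R) (w : T) : path_space R :=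
  exist (fun f : R -> R => {within `[0, +oo[, continuous f}) _ (@continuous_drifted x w).

Section PathLaw.
Variables (h x : R).
Hypothesis h0 : 0 <= h.

Definition shifted_path (w : T) : path_space R :=
  exist (fun f : R -> R => {within `[0, +oo[, continuous f}) _
    (within_continuous_shift h0 (@continuous_drifted x w)).

Definition restarted_path (p : T * T) : path_space R :=
  drifted_path (drifted B mu x h p.1) p.2.

Lemma measurable_drifted y t : measurable_fun setT (drifted B mu y t).
Proof. by apply: measurable_funD. Qed.

Lemma measurable_drifted_path y : measurable_fun setT (drifted_path y).
Proof.
apply: (@measurable_into_coord R (halfline_path R) _ (@path_at R)) => t.
exact: measurable_drifted.
Qed.

Lemma measurable_shifted_path : measurable_fun setT shifted_path.
Proof.
apply: (@measurable_into_coord R (halfline_path R) _ (@path_at R)) => t.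
exact: measurable_drifted.
Qed.

Lemma measurable_restarted_path : measurable_fun setT restarted_path.
Proof.
apply: (@measurable_into_coord R (halfline_path R) _ (@path_at R)) => t.
apply: measurable_funD; last exact: measurableT_comp.
apply: measurable_funB => //; apply: measurableT_comp => //.
exact: measurable_drifted.
Qed.

(** Markov property at time h. A cylinder event sees finitely many times; along their sorted grid,
    path values are partial sums of increments, so the claim reduces to [increments_law]. *)
Lemma shifted_path_law (S : set (path_space R)) : measurable S ->
  P (shifted_path @^-1` S) = (P \x P)%E (restarted_path @^-1` S).
Proof.
have ms := measurable_shifted_path; have mr := measurable_restarted_path.
move: S; change (forall S : set (path_space R), measurable S ->
  pushforward P shifted_path S = pushforward (P \x P)%E restarted_path S).
apply: coord_law_unique.
  by rewrite -[ltLHS]/(P (shifted_path @^-1` setT)) preimage_setT probability_setT ltry.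
move=> l _ A mA; rewrite /= /pushforward.
pose tt : seq R := 0 :: sort <=%R [seq t%:num | t : {nonneg R} <- l].
have stt : sorted <=%R tt.
  rewrite /tt /sorted path_min_sorted; first exact: sort_le_sorted.
  by apply/allP => t; rewrite mem_sort => /mapP[u _ ->].
(* Past its end the grid stays constant, so it is monotone at every index; the 0 put in front gives
   [s 0 = 0]. *)
pose s i := nth (last 0 tt) tt i.
have s0 : s 0%N = 0 by [].
have sS i : s i <= s i.+1.
  have [iS|Si] := ltnP i.+1 (size tt).
    by apply: (sorted_leq_nth le_trans lexx) => //; rewrite inE ltnW.
  rewrite /s [leRHS]nth_default//.
  have [i1|i1] := ltnP i (size tt); last by rewrite nth_default.
  have -> : i = (size tt).-1.
    case: (size tt) Si i1 => // n; rewrite !ltnS => ni iln.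
    by apply/eqP; rewrite eqn_leq iln ni.
  by rewrite nth_last.
pose j (t : {nonneg R}) := index t%:num tt.
have sj t : t \in l -> s (j t) = t%:num.
  move=> tl; rewrite /s /j nth_index// inE mem_sort map_f ?orbT//.
(* The value at time h + t is a sum of [(j t).+1] increments: one up to h and [j t] more along
   [s]. *)
pose S : set (g_sigma_algebraType (coord_sets (fun (i : nat) (e : nat -> R) => e i))) :=
  [set e | forall t, t \in l ->
    A t (x - mu * (h + t%:num) + \sum_(0 <= i < (j t).+1) e i)].
have mS : measurable S.
  rewrite (_ : S = \big[setI/setT]_(t <- l)
     [set e | A t (x - mu * (h + t%:num) + \sum_(0 <= i < (j t).+1) e i)]); last first.
    by rewrite -bigcap_seq; apply/seteqP; split=> e /=.
  apply: bigsetI_measurable => t _; rewrite -[X in measurable X]setTI.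
  apply: (measurable_funD (f := cst (x - mu * (h + t%:num)))) => //.
  apply: measurable_sum => i.
  exact: (@measurable_coord R (nat -> R) _ (fun i e => e i)).
have sum_grid w t : t \in l ->
    \sum_(0 <= i < (j t).+1) grid_increments h s w i = B (h + t%:num) w.
  move=> tl; rewrite telescope_sumr//= sj//.
  by rewrite (bm_start hB) subr0.
have sum_split w t : t \in l ->
    \sum_(0 <= i < (j t).+1) split_increments h s w i = B h w.1 + B t%:num w.2.
  move=> tl; rewrite big_nat_recl//= telescope_sumr//= sj// s0.
  by rewrite !(bm_start hB) !subr0.
have := increments_law h0 s0 sS mS.
have -> : grid_increments h s @^-1` S = shifted_path @^-1`
    [set f | forall t, t \in l -> A t (path_at t f)].
  apply/seteqP; split=> w /= wS t tl; have := wS t tl; rewrite sum_grid//.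
have -> // : split_increments h s @^-1` S = restarted_path @^-1`
    [set f | forall t, t \in l -> A t (path_at t f)].
suff e w t : t \in l -> x - mu * (h + t%:num) + (B h w.1 + B t%:num w.2) =
    path_at t (restarted_path w).
  by apply/seteqP; split=> w /= wS t tl; have := wS t tl; rewrite sum_split// e.
by move=> _; rewrite /path_at/= /drifted; ring.
Qed.

End PathLaw.
End MarkovProperty.

(** * Moments of the restarted path *)

Section KilledPath.
Context {R : realType}.
Notation E := (path_space R).

(* Off [positive_start] both functionals are [0]: a path restarted at or below
   the origin contributes nothing.  [fine] also makes them [0] where the
   extended-real value is infinite. *)
Definition killed_time (f : E) : R :=
  if f \in @positive_start R then fine (first_passage (sval f)) else 0.

Definition killed_area (f : E) : R :=
  if f \in @positive_start R then fine (passage_area (sval f)) else 0.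

Lemma passage_area_ge0 (f : E) : positive_start f -> (0 <= passage_area (sval f))%E.
Proof.
move=> f0; apply: integral_ge0 => t [t0 tf]; rewrite lee_fin.
exact: (ge0_until_passage (svalP f)).
Qed.

Lemma killed_time_ge0 f : 0 <= killed_time f.
Proof. by rewrite /killed_time; case: ifP => // _; rewrite fine_ge0// first_passage_ge0. Qed.

Lemma killed_area_ge0 f : 0 <= killed_area f.
Proof.
rewrite /killed_area; case: ifPn => // /[!inE] f0.
by rewrite fine_ge0// passage_area_ge0.
Qed.

Lemma measurable_killed_time : measurable_fun setT killed_time.
Proof.
have mD := @measurable_positive_start R.
apply: (eq_measurable_fun ((fun f : E => fine (first_passage (sval f))) \_ (@positive_start R))).
  by move=> f _; rewrite patchE /killed_time; case: ifP.
apply/(measurable_restrictT _ mD).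
apply: (measurable_comp (F := setT)) => //; last exact: measurable_first_passage.
Qed.

Lemma measurable_killed_area : measurable_fun setT killed_area.
Proof.
have mD := @measurable_positive_start R.
apply: (eq_measurable_fun ((fun f : E => fine (passage_area (sval f))) \_ (@positive_start R))).
  by move=> f _; rewrite patchE /killed_area; case: ifP.
apply/(measurable_restrictT _ mD).
apply: (measurable_comp (F := setT)) => //; last exact: measurable_passage_area.
Qed.

Definition killed_moment (p q : nat) (f : E) : R := killed_time f ^+ p * killed_area f ^+ q.

Lemma killed_moment_ge0 p q f : 0 <= killed_moment p q f.
Proof. by rewrite mulr_ge0// exprn_ge0// ?killed_time_ge0 ?killed_area_ge0. Qed.

Lemma measurable_killed_moment p q : measurable_fun setT (killed_moment p q).
Proof.
apply: measurable_funM; apply: measurable_funX; first exact: measurable_killed_time.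
exact: measurable_killed_area.
Qed.

End KilledPath.

Section MarkovMoments.
Context d (T : measurableType d) (R : realType) (P : probability T R).
Variables (B : R -> {RV P >-> R}) (mu : R).
Hypothesis hB : standard_brownian_motion B.


Lemma markov_integral (h x : R) (h0 : 0 <= h) (phi : path_space R -> \bar R) :
  measurable_fun setT phi -> (forall f, (0 <= phi f)%E) ->
  (\int[P]_w phi (shifted_path mu hB x h0 w) =
   \int[P]_w \int[P]_w' phi (drifted_path mu hB (drifted B mu x h w) w'))%E.
Proof.
move=> mphi phi0.
have ms := measurable_shifted_path mu hB x h0.
have mr := measurable_restarted_path mu hB h x.
transitivity (\int[pushforward P (shifted_path mu hB x h0)]_f phi f)%E.
  by rewrite ge0_integral_pushforward//.
transitivity (\int[pushforward (P \x P)%E (restarted_path mu hB h x)]_f phi f)%E.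
  by apply: eq_measure_integral => S mS _; exact: shifted_path_law.
rewrite ge0_integral_pushforward//.
rewrite preimage_setT (fubini_tonelli1 (phi \o restarted_path mu hB h x))//.
  exact: measurableT_comp.
by move=> p; exact: phi0.
Qed.

Variable a : forall p q : nat, 'cV[R]_(p + 2 * q).
Hypothesis ha : forall p q : nat, (0 < p + q)%N -> forall x : R, 0 < x ->
  joint_moment B mu p q x = (\sum_(k < p + 2 * q) a p q k 0 * x ^+ k.+1)%:E.

Definition moment_poly (p q : nat) : {poly R} :=
  \sum_(k < p + 2 * q) a p q k 0 *: 'X^(k.+1).

Lemma horner_moment_poly p q x :
  (moment_poly p q).[x] = \sum_(k < p + 2 * q) a p q k 0 * x ^+ k.+1.
Proof.
by rewrite horner_sum; apply: eq_bigr => k _; rewrite hornerZ hornerXn.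
Qed.

Lemma joint_momentE p q y : joint_moment B mu p q y =
  (\int[P]_w (first_passage (sval (drifted_path mu hB y w)) ^+ p *
              passage_area (sval (drifted_path mu hB y w)) ^+ q))%E.
Proof. by []. Qed.

Lemma positive_start_drifted y w : 0 < y -> positive_start (drifted_path mu hB y w).
Proof.
by rewrite /positive_start/= /drifted mulr0 subr0 (bm_start hB) addr0.
Qed.

Lemma measurable_drifted_passage y : 0 < y ->
  measurable_fun setT (fun w => first_passage (sval (drifted_path mu hB y w))).
Proof.
move=> y0; apply: (@measurable_comp _ _ _ _ _ _ (@positive_start R)
  (fun f : path_space R => first_passage (sval f)) setT (drifted_path mu hB y)).
- exact: measurable_positive_start.
- by move=> _ [w _ <-]; apply: (positive_start_drifted w y0).
- exact: measurable_first_passage.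
- exact: measurable_drifted_path.
Qed.

Lemma measurable_drifted_area y : 0 < y ->
  measurable_fun setT (fun w => passage_area (sval (drifted_path mu hB y w))).
Proof.
move=> y0; apply: (@measurable_comp _ _ _ _ _ _ (@positive_start R)
  (fun f : path_space R => passage_area (sval f)) setT (drifted_path mu hB y)).
- exact: measurable_positive_start.
- by move=> _ [w _ <-]; apply: (positive_start_drifted w y0).
- exact: measurable_passage_area.
- exact: measurable_drifted_path.
Qed.

Lemma ge0_finite_integral_ae (f : T -> \bar R) : measurable_fun setT f ->
  (forall w, (0 <= f w)%E) -> (\int[P]_w f w < +oo)%E -> {ae P, forall w, f w \is a fin_num}.
Proof.
move=> mf f0 foo.
have : P.-integrable setT f.
  apply/integrableP; split=> //; under eq_integral do rewrite gee0_abs//.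
  exact: foo.
by move=> /(integrable_ae measurableT); apply: filterS => w; exact.
Qed.

(** The case (1, 0) of [ha] gives a finite mean, hence almost sure finiteness; the area uses (0, 1)
    likewise. *)
Lemma drifted_passage_finite y : 0 < y ->
  {ae P, forall w, first_passage (sval (drifted_path mu hB y w)) \is a fin_num}.
Proof.
move=> y0; apply: ge0_finite_integral_ae; first exact: measurable_drifted_passage.
  by move=> w; exact: first_passage_ge0.
have := ha (p := 1) (q := 0) isT y0; rewrite joint_momentE.
by under eq_integral do rewrite expe0 mule1; move=> ->; rewrite ltry.
Qed.

Lemma drifted_area_finite y : 0 < y ->
  {ae P, forall w, passage_area (sval (drifted_path mu hB y w)) \is a fin_num}.
Proof.
move=> y0; apply: ge0_finite_integral_ae; first exact: measurable_drifted_area.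
  by move=> w; apply: passage_area_ge0; exact: positive_start_drifted.
have := ha (p := 0) (q := 1) isT y0; rewrite joint_momentE.
by under eq_integral do rewrite expe0 mul1e; move=> ->; rewrite ltry.
Qed.

Lemma emeasurable_funX (f : T -> \bar R) n : measurable_fun setT f ->
  measurable_fun setT (fun w => f w ^+ n)%E.
Proof.
move=> mf; elim: n => [|n IH]; first by [].
by under eq_fun do rewrite expeS; exact: emeasurable_funM.
Qed.

Lemma killed_moment_from p q y : (0 < p + q)%N -> 0 < y ->
  (\int[P]_w (killed_moment p q (drifted_path mu hB y w))%:E = (moment_poly p q).[y]%:E)%E.
Proof.
move=> pq y0; rewrite horner_moment_poly -ha// joint_momentE.
have mt := measurable_drifted_passage y0; have mA := measurable_drifted_area y0.
apply: ae_eq_integral => //.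
- apply/measurable_EFinP; apply: measurableT_comp; first exact: measurable_killed_moment.
  exact: measurable_drifted_path.
- by apply: emeasurable_funM; exact: emeasurable_funX.
- have := drifted_area_finite y0; have := drifted_passage_finite y0.
  apply: filterS2 => w tf af _; rewrite /killed_moment /killed_time /killed_area.
  rewrite mem_set; last exact: positive_start_drifted.
  by rewrite EFinM !EFin_expe !fineK.
Qed.

Lemma killed_moment_after p q h x (h0 : 0 <= h) : (0 < p + q)%N ->
  (\int[P]_w (killed_moment p q (shifted_path mu hB x h0 w))%:E =
   \int[P]_w (if (0 < drifted B mu x h w)%R then (moment_poly p q).[drifted B mu x h w]
              else 0)%:E)%E.
Proof.
move=> pq; rewrite (markov_integral x h0 (phi := fun f => (killed_moment p q f)%:E)).
- apply: eq_integral => w _; case: ifPn => y0; first exact: killed_moment_from.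
  apply: integral0_eq => w' _; rewrite /killed_moment /killed_time /killed_area.
  rewrite memNset.
    (* [0 < p + q] leaves at least one factor 0; for p = q = 0 the product would be 1. *)
    by case: p q pq => [|p] [|q] // _; rewrite ?expr0n/= ?mul0r ?mulr0.
  by rewrite /positive_start/= {1}/drifted mulr0 subr0 (bm_start hB) addr0; exact/negP.
- by apply/measurable_EFinP; exact: measurable_killed_moment.
- by move=> f; rewrite lee_fin killed_moment_ge0.
Qed.

End MarkovMoments.

(** * Gaussian expectations of polynomials *)

Section GaussianLaw.
Context {R : realType}.
Notation mu := (@lebesgue_measure R).

Lemma scaled_measure_exists (r : R) :
  exists pm : {measure set (measurableTypeR R) -> \bar R},
  (forall C, pm C = mu [set t | C (r * t)%R]) /\
  forall D (f : R -> \bar R), measurable D -> measurable_fun D f ->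
    (forall x, D x -> (0 <= f x)%E) ->
    (\int[pm]_(x in D) f x = \int[mu]_(x in [set t | D (r * t)%R]) f (r * x)%R)%E.
Proof.
pose phi := fun t : measurableTypeR R => (r * t : measurableTypeR R).
have mphi : measurable_fun setT phi by exact: measurable_funM.
unshelve refine (ex_intro _ (pushforward mu phi : {measure set (measurableTypeR R) -> \bar R}) _) => //.
split=> // D f mD mf f0; rewrite ge0_integral_pushforward//.
by move=> x; rewrite inE; exact: f0.
Qed.

Lemma lebesgue_measureZ (r : R) (A : set R) : r != 0 -> measurable A ->
  (mu A = `|r|%:E * mu [set t | A (r * t)%R])%E.
Proof.
move=> r0 mA; have [pm [pmE _]] := scaled_measure_exists r.
transitivity (mscale (NngNum (normr_ge0 r)) pm A); last by rewrite /mscale/= pmE.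
apply: lebesgue_measure_unique => // _ [[a b]] _ <- /=.
rewrite /mscale/= pmE.
have [r1|r1] := ltP 0 r.
  rewrite (_ : [set t | `]a, b]%classic (r * t)] = `](r^-1 * a), (r^-1 * b)]%classic); last first.
    apply/funext => t; rewrite /= !in_itv/= ![r^-1 * _]mulrC.
    by rewrite ltr_pdivrMr// ler_pdivlMr// [t * r]mulrC.
  rewrite !lebesgue_measure_itv/= !lte_fin ltr_pM2l ?invr_gt0//.
  case: ifPn => _; last by rewrite mule0.
  by rewrite -!EFinB -EFinM gtr0_norm// -mulrBr mulrA divff ?mul1r.
have rN : r < 0 by rewrite lt_neqAle r0.
rewrite (_ : [set t | `]a, b]%classic (r * t)] = `[(r^-1 * b), (r^-1 * a)[%classic); last first.
  apply/funext => t; rewrite /= !in_itv/= ![r^-1 * _]mulrC.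
  by rewrite ltr_ndivlMr// ler_ndivrMr// [t * r]mulrC andbC.
rewrite !lebesgue_measure_itv/= !lte_fin ltr_nM2l ?invr_lt0//.
case: ifPn => _; last by rewrite mule0.
rewrite -!EFinB -EFinM ltr0_norm// -mulrBr mulrA mulNr divff// mulN1r opprB//.
Qed.

(** Besides the scaling of increments, r = -1 gives the symmetry from which the mean is 0. *)
Lemma normal_probZ (r : R) (U : set R) : r != 0 -> measurable U ->
  normal_prob 0 r U = normal_prob 0 1 [set t | U (r * t)].
Proof.
move=> r0 mU; have [pm [pmE pm_int]] := scaled_measure_exists r.
have mpdf s : measurable_fun setT (fun x => (normal_pdf 0 s x)%:E : \bar R).
  by apply/measurable_EFinP; exact: measurable_normal_pdf.
rewrite /normal_prob.
transitivity (\int[mscale (NngNum (normr_ge0 r)) pm]_(x in U) (normal_pdf 0 r x)%:E)%E.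
  apply: eq_measure_integral => A mA _.
  by transitivity (`|r|%:E * pm A)%E => //; rewrite pmE; exact: lebesgue_measureZ.
rewrite ge0_integral_mscale//; last 2 first.
- exact: measurable_funTS (mpdf r).
- by move=> x _; rewrite lee_fin normal_pdf_ge0.
rewrite pm_int//; last 2 first.
- exact: measurable_funTS (mpdf r).
- by move=> x _; rewrite lee_fin normal_pdf_ge0.
have mr : measurable_fun setT (fun t : R => r * t) by exact: measurable_funM.
have mrU : measurable [set t | U (r * t)] by rewrite -[X in measurable X]setTI; exact: mr.
rewrite -ge0_integralZl//; last 2 first.
- apply: measurable_funTS.
  exact: (measurableT_comp (f := fun x => (normal_pdf 0 r x)%:E : \bar R)).
- by move=> x _; rewrite lee_fin normal_pdf_ge0.
apply: eq_integral => x _; rewrite -EFinM !normal_pdfE ?oner_eq0//=; congr _%:E.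
rewrite mulrA; congr (_ * _).
  rewrite /normal_peak expr1n -!mulrnAr sqrtrM ?sqr_ge0// sqrtr_sqr mul1r.
  by rewrite invfM mulrA divff ?mul1r// normr_eq0.
rewrite /normal_fun !subr0 exprMn expr1n; congr (expR _).
by rewrite -mulr_natr; field.
Qed.

(** The Radon-Nikodym derivative agrees almost everywhere with [normal_pdf] because both have the
    same integral over every measurable set. *)
Lemma normal_prob_density (s : R) (f : R -> \bar R) : measurable_fun setT f ->
  (forall x, (0 <= f x)%E) ->
  (\int[normal_prob 0 s]_x f x = \int[mu]_x (f x * (normal_pdf 0 s x)%:E))%E.
Proof.
move=> mf f0; have dom := normal_prob_dominates 0 s.
rewrite -(Radon_Nikodym_SigmaFinite.change_of_variables dom)//.
have mpdf : measurable_fun setT (fun x => (normal_pdf 0 s x)%:E : \bar R).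
  by apply/measurable_EFinP; exact: measurable_normal_pdf.
have iRN := Radon_Nikodym_SigmaFinite.f_integrable dom.
apply: ae_eq_integral => //.
- by apply: emeasurable_funM => //; exact: measurable_int iRN.
- exact: emeasurable_funM.
- apply: ae_eqe_mul2l; apply: integral_ae_eq => // E _ mE.
  by rewrite -Radon_Nikodym_SigmaFinite.f_integral.
Qed.

(** Completing the square turns the integrand into a multiple of the normal density centred at c. *)
Lemma integral_normal_expR (c : R) :
  (\int[normal_prob 0 1]_z (expR (c * z))%:E = (expR (c ^+ 2 / 2))%:E)%E.
Proof.
rewrite normal_prob_density//; last first.
  by apply/measurable_EFinP; apply: measurableT_comp.
have mpdf : measurable_fun setT (fun x => (normal_pdf c 1 x)%:E : \bar R).
  by apply/measurable_EFinP; exact: measurable_normal_pdf.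
have pdf0 x : [set: R] x -> (0 <= (normal_pdf c 1 x)%:E)%E.
  by move=> _; rewrite lee_fin normal_pdf_ge0.
transitivity (\int[mu]_x ((expR (c ^+ 2 / 2))%:E * (normal_pdf c 1 x)%:E))%E; last first.
  rewrite ge0_integralZl_EFin//.
  by rewrite integral_normal_pdf mule1.
apply: eq_integral => x _; rewrite -!EFinM !normal_pdfE ?oner_eq0//; congr _%:E.
rewrite mulrCA [RHS]mulrCA; congr (_ * _).
rewrite /normal_fun -!expRD; congr (expR _).
by rewrite expr1n -mulr_natr; field.
Qed.

Let g (x : R) : R := expR (- (x ^+ 2 / 2)).

Let is_derive_g (x : R) : is_derive x (1:R) g (- (x * g x)).
Proof.
rewrite /g; apply: is_derive_eq.
rewrite /GRing.scale/= !mulr0 add0r !mulr1; set e := expR _.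
by rewrite mulrN mulrC; congr (- (_ * _)); lra.
Qed.

Let continuous_g : continuous g.
Proof.
move=> x; have [dg _] := is_derive_g x.
exact/differentiable_continuous/derivable1_diffP.
Qed.

(** Integration by parts for the factor x and the antiderivative -g of x g. The boundary term stands
    on the left to avoid an extended-real subtraction; it vanishes in the limit, so the second
    moment equals the total mass. *)
Lemma integral_gauss_parts (n : nat) :
  (\int[mu]_(x in `[0%R, n%:R]) (x ^+ 2 * g x)%:E + (n%:R * g n%:R)%:E =
   \int[mu]_(x in `[0%R, n%:R]) (g x)%:E)%E.
Proof.
case: n => [|n]; first by rewrite set_itv1 !integral_set1 mul0r adde0.
have n0 : (0 : R) < n.+1%:R by [].
have dg (x : R) : is_derive x (1:R) (fun y => - g y : R) (x * g x).
  by rewrite -[x * g x]opprK; apply: is_deriveN.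
have cg := continuous_g.
have cid : continuous (fun x : R => x) by move=> x; exact: cvg_id.
have Ng0 : derivable_oo_LRcontinuous (fun x => - g x) 0 n.+1%:R.
  split; [by move=> x _; case: (dg x)|apply: cvg_at_right_filter|apply: cvg_at_left_filter].
    by apply: cvgN; exact: cg.
  by apply: cvgN; exact: cg.
have id0 : derivable_oo_LRcontinuous (fun x : R => x) 0 n.+1%:R.
  split=> //; [apply: cvg_at_right_filter|apply: cvg_at_left_filter]; exact: cvg_id.
have -> : (\int[mu]_(x in `[0%R, n.+1%:R]) (x ^+ 2 * g x)%:E =
           \int[mu]_(x in `[0%R, n.+1%:R]) (x * (x * g x))%:E)%E.
  by apply: eq_integral => x _; rewrite mulrA.
rewrite (@integration_by_parts R (fun x => x) (fun x => - g x) (fun=> 1) (fun x => x * g x)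
  0 n.+1%:R n0)//.
- rewrite mul0r subr0 mulrN.
  under [in LHS]eq_integral do rewrite mul1r EFinN.
  rewrite integral_ge0N; last by move=> x _; rewrite lee_fin expR_ge0.
  by rewrite oppeK addeAC -EFinD addNr add0e.
- by apply: continuous_subspaceT => x; exact: cvg_cst.
- by move=> x _; rewrite derive1E derive_id.
- by apply: continuous_subspaceT => x; apply: cvgM; [exact: cvg_id|exact: cg].
- by move=> x _; rewrite derive1E; apply: derive_val.
Qed.

Lemma cvg_mul_gauss : n%:R * g n%:R @[n --> \oo] --> (0 : R).
Proof.
apply/cvgrPdist_le => e e0; near=> n.
have n0 : 0 < n%:R :> R by rewrite ltr0n; near: n; exact: nbhs_infty_gt.
rewrite sub0r normrN ger0_norm; last by rewrite mulr_ge0// expR_ge0.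
(* From [expR (n^2 / 2) >= 1 + n^2 / 2]. *)
apply: (@le_trans _ _ (2 / n%:R)).
  rewrite /g expRN ler_pdivrMr ?expR_gt0//.
  apply: (@le_trans _ _ (2 / n%:R * (1 + n%:R ^+ 2 / 2))).
    have -> : 2 / n%:R * (1 + n%:R ^+ 2 / 2) = 2 / n%:R + n%:R :> R.
      by field; rewrite gt_eqF.
    by rewrite lerDr divr_ge0// ltW.
  by apply: ler_wpM2l; [rewrite divr_ge0// ltW|exact: expR_ge1Dx].
rewrite ler_pdivrMr// -ler_pdivrMl// mulrC.
near: n; exact: nbhs_infty_ger.
Unshelve. all: by end_near. Qed.

Lemma integral_normal_sqr :
  (\int[normal_prob 0 1]_z (z ^+ 2)%:E = 1%:E :> \bar R)%E.
Proof.
have pdfE z : normal_pdf 0 1 z = normal_peak 1 * g z.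
  by rewrite normal_pdfE ?oner_eq0// /normal_fun subr0 expr1n /g -mulr_natr mul1r mulNr.
have peak0 : 0 <= normal_peak (1 : R) by exact: normal_peak_ge0.
have cg := continuous_g.
have mg : measurable_fun setT g by exact: continuous_measurable_fun.
have mzg : measurable_fun setT (fun z : R => z ^+ 2 * g z) by exact: measurable_funM.
rewrite normal_prob_density//; last first.
- by move=> x; rewrite lee_fin sqr_ge0.
- by apply/measurable_EFinP; exact: measurable_funX.
rewrite -(integral_normal_pdf 0 1).
under eq_integral do rewrite pdfE -EFinM mulrCA EFinM.
under [RHS]eq_integral do rewrite pdfE EFinM.
have g0 x : 0 <= g x by exact: expR_ge0.
have zg0 x : 0 <= x ^+ 2 * g x by rewrite mulr_ge0 ?sqr_ge0.
have mg' : measurable_fun setT (fun x => (g x)%:E : \bar R) by exact/measurable_EFinP.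
have mzg' : measurable_fun setT (fun x : R => (x ^+ 2 * g x)%:E) by exact/measurable_EFinP.
have g0' x : [set: R] x -> (0 <= (g x)%:E)%E by rewrite lee_fin.
have zg0' x : [set: R] x -> (0 <= (x ^+ 2 * g x)%:E)%E by rewrite lee_fin.
rewrite !ge0_integralZl_EFin//; congr (_ * _)%E.
have czg : continuous (fun x : R => x ^+ 2 * g x).
  by move=> x; apply: cvgM; [exact: exprn_continuous|exact: cg].
have sg : g =1 g \o -%R by move=> x /=; rewrite /g sqrrN.
have szg : (fun x : R => x ^+ 2 * g x) =1 (fun x : R => x ^+ 2 * g x) \o -%R.
  by move=> x /=; rewrite /g sqrrN.
rewrite (ge0_symfun_integralT zg0 czg szg) (ge0_symfun_integralT g0 cg sg).
congr (_ * _)%E.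
rewrite -set_itvcy.
have l1 := ge0_cvgn_integral (mu := mu) zg0 mzg.
have l2 := ge0_cvgn_integral (mu := mu) g0 mg.
have l3 : ((n%:R * g n%:R)%:E @[n --> \oo] --> (0%:E : \bar R))%E.
  by apply: cvg_EFin; [exact: nearW|exact: cvg_mul_gauss].
have l13 : (\int[mu]_(x in `[0%R, n%:R]) (g x)%:E)%E @[n --> \oo] -->
    (\int[mu]_(x in `[0%R, +oo[) (x ^+ 2 * g x)%:E)%E.
  rewrite -(funext integral_gauss_parts) -[X in _ --> X]adde0.
  by apply: cvgeD => //; exact: fin_num_adde_defl.
exact: cvg_unique l13 l2.
Qed.

End GaussianLaw.

(** * Taylor expansion of polynomials under a Gaussian law *)

Section PolynomialGrowth.
Context {R : realType}.

Lemma poly_growth (q : {poly R}) (x : R) : exists C k, 0 <= C /\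
  forall u, `|q.[x + u]| <= C * (1 + `|u|) ^+ k.
Proof.
elim/poly_ind: q => [|q c [C [k [C0 qC]]]].
  by exists 0, 0%N; split=> // u; rewrite horner0 normr0 mul0r.
exists (C * (1 + `|x|) + `|c|), k.+1; split=> [|u].
  by rewrite addr_ge0// mulr_ge0// addr_ge0.
rewrite !hornerE exprS; set y := 1 + `|u|.
have y1 : 1 <= y by rewrite lerDl.
have y0 : 0 <= y by apply: le_trans y1.
have yk1 : 1 <= y * y ^+ k by rewrite -exprS exprn_ege1.
apply: (le_trans (ler_normD _ _)); rewrite mulrDl lerD//; last by rewrite ler_peMr.
rewrite normrM mulrCA -!mulrA [leRHS]mulrCA.
have xu : `|x + u| <= (1 + `|x|) * y.
  apply: le_trans (ler_normD _ _) _; rewrite /y.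
  have := mulr_ge0 (normr_ge0 x) (normr_ge0 u); lra.
rewrite [leLHS]mulrC [leRHS](_ : _ = ((1 + `|x|) * y) * (C * y ^+ k)); last by ring.
by rewrite ler_pM// qC.
Qed.

(** Horner induction: the second-order remainder of q X + c is x + u times that of q, plus q''(x) /
    2 times u^3. *)
Lemma poly_taylor2_bound (q : {poly R}) (x : R) : exists C k, 0 <= C /\
  forall u, `|q.[x + u] - (q.[x] + q^`().[x] * u + q^`(2).[x] / 2 * u ^+ 2)|
    <= C * `|u| ^+ 3 * (1 + `|u|) ^+ k.
Proof.
elim/poly_ind: q => [|q c [C [k [C0 qC]]]].
  exists 0, 0%N; split=> // u; rewrite derivnS derivn1 !deriv0 !horner0.
  by rewrite !mul0r !addr0 subrr normr0.
exists (C * (1 + `|x|) + `|q^`(2).[x] / 2|), k.+1; split=> [|u].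
  by rewrite addr_ge0// mulr_ge0// addr_ge0.
set y := 1 + `|u|.
have y1 : 1 <= y by rewrite lerDl.
have y0 : 0 <= y by apply: le_trans y1.
have -> : (q * 'X + c%:P).[x + u] - ((q * 'X + c%:P).[x] + (q * 'X + c%:P)^`().[x] * u +
    (q * 'X + c%:P)^`(2).[x] / 2 * u ^+ 2) =
    (x + u) * (q.[x + u] - (q.[x] + q^`().[x] * u + q^`(2).[x] / 2 * u ^+ 2)) +
    q^`(2).[x] / 2 * u ^+ 3.
  have d1 : (q * 'X + c%:P)^`() = q^`() * 'X + q.
    by rewrite derivD derivM derivX derivC mulr1 addr0.
  have d2 : (q * 'X + c%:P)^`(2) = q^`(2) * 'X + q^`() + q^`().
    by rewrite derivnS derivn1 d1 derivD derivM derivX mulr1 derivnS derivn1.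
  rewrite d1 d2 !hornerD !hornerMX !hornerC.
  move: (q^`(2).[x]) (q^`().[x]) (q.[x]) (q.[x + u]) => b2 b1 b0 bu.
  by field.
rewrite (_ : (C * (1 + `|x|) + `|q^`(2).[x] / 2|) * `|u| ^+ 3 * y ^+ k.+1 =
  C * (1 + `|x|) * `|u| ^+ 3 * y ^+ k.+1 + `|q^`(2).[x] / 2| * `|u| ^+ 3 * y ^+ k.+1); last by ring.
apply: (le_trans (ler_normD _ _)); rewrite lerD//.
  rewrite normrM.
  have xu : `|x + u| <= (1 + `|x|) * y.
    apply: le_trans (ler_normD _ _) _; rewrite /y.
    have := mulr_ge0 (normr_ge0 x) (normr_ge0 u); lra.
  rewrite [y ^+ k.+1]exprS [leRHS](_ : _ = ((1 + `|x|) * y) * (C * `|u| ^+ 3 * y ^+ k)); last by ring.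
  by rewrite ler_pM.
by rewrite normrM normrX ler_peMr ?mulr_ge0 ?exprn_ge0// exprn_ege1.
Qed.

End PolynomialGrowth.

Section GaussianExpansion.
Context {R : realType}.
Notation N := (@normal_prob R 0 1).

Lemma integrable_gauss_growth (k : nat) :
  N.-integrable setT (fun z => ((1 + `|z|) ^+ k)%:E).
Proof.
have mz : measurable_fun setT (fun z : R => (1 + `|z|) ^+ k).
  by apply: measurable_funX; apply: measurable_funD => //; exact: measurableT_comp.
apply/integrableP; split; first exact/measurable_EFinP.
(* With y = 1 + |z|: y^(k+1) <= (k+1)! e^y, and e^|z| <= e^z + e^(-z). *)
pose c : R := k.+1`!%:R * expR 1.
apply: (@le_lt_trans _ _ (\int[N]_z (c%:E * ((expR (1 * z))%:E + (expR (-1 * z))%:E)))%E).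
  apply: ge0_le_integral => //.
  - by apply: measurableT_comp => //; exact/measurable_EFinP.
  - apply: emeasurable_funM => //; apply: emeasurable_funD.
      by apply/measurable_EFinP; apply: measurableT_comp.
    by apply/measurable_EFinP; apply: measurableT_comp.
  move=> z _; rewrite /= -EFinD -EFinM lee_fin.
  have z1 : 1 <= 1 + `|z| by rewrite lerDl.
  have z0 : 0 <= 1 + `|z| by apply: le_trans z1.
  rewrite ger0_norm ?exprn_ge0//.
  apply: (@le_trans _ _ ((1 + `|z|) ^+ k.+1)); first by rewrite exprS ler_peMl// exprn_ge0.
  have f0 : 0 < k.+1`!%:R :> R by rewrite ltr0n fact_gt0.
  have := expR_ge1Dxn k z0 => /(le_trans _) => /(_ ((1 + `|z|) ^+ k.+1 / k.+1`!%:R)).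
  rewrite lerDr ler01 => /(_ isT); rewrite ler_pdivrMr// => /le_trans; apply.
  rewrite expRD /c [leRHS](_ : _ = expR 1 * (expR (1 * z) + expR (-1 * z)) * k.+1`!%:R); last by ring.
  rewrite ler_wpM2r// ler_wpM2l ?expR_ge0// mul1r mulN1r.
  by case: (ger0P z) => _; rewrite ?lerDl ?lerDr expR_ge0.
rewrite ge0_integralZl_EFin//; last 3 first.
- by move=> z _; rewrite adde_ge0// lee_fin expR_ge0.
- apply: emeasurable_funD.
    by apply/measurable_EFinP; apply: measurableT_comp.
  by apply/measurable_EFinP; apply: measurableT_comp.
- by rewrite /c mulr_ge0// expR_ge0.
have me (t : R) : measurable_fun setT (fun z => (expR (t * z))%:E).
  by apply/measurable_EFinP; apply: measurableT_comp.
rewrite ge0_integralD//.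
by rewrite !integral_normal_expR -EFinD -EFinM ltry.
all: exact: me.
Qed.

Lemma integrable_gauss_le (f : R -> R) (C : R) (k : nat) : measurable_fun setT f ->
  (forall z, `|f z| <= C * (1 + `|z|) ^+ k) -> N.-integrable setT (EFin \o f).
Proof.
move=> mf fC; have iC := integrableZl measurableT C (integrable_gauss_growth k).
apply: le_integrable iC => //; first exact/measurable_EFinP.
move=> z _ /=; rewrite lee_fin (le_trans (fC z))// ler_norm//.
Qed.

Lemma integral_normal_id : (\int[N]_z z%:E = 0 :> \bar R)%E.
Proof.
have iz : N.-integrable setT (EFin : R -> \bar R).
  by apply: (integrable_gauss_le (C := 1) (k := 1)) => // z; rewrite mul1r expr1 lerDr.
pose phi := fun z : measurableTypeR R => (- z : measurableTypeR R).
have mphi : measurable_fun setT phi by exact: oppr_measurable.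
have e : (\int[N]_z z%:E = - \int[N]_z z%:E :> \bar R)%E.
  rewrite -integralN; last exact: integrable_add_def.
  rewrite (_ : (\int[N]_z - z%:E = \int[pushforward N phi]_z z%:E)%E); last first.
    rewrite integral_pushforward// preimage_setT.
    apply: (integrable_gauss_le (f := phi) (C := 1) (k := 1)) => // z.
    by rewrite mul1r expr1 /phi normrN lerDr.
  apply: eq_measure_integral => A mA _.
  have n1 : (-1 : R) != 0 by rewrite oppr_eq0 oner_eq0.
  have := normal_probZ n1 mA.
  rewrite (_ : normal_prob 0 (-1) A = N A); last first.
    rewrite /normal_prob; apply: eq_integral => z _; rewrite !normal_pdfE ?oner_eq0//.
    by rewrite /normal_peak /normal_fun sqrrN.
  move=> e; apply: (etrans e); rewrite -[RHS]/(N (phi @^-1` A)).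
  by congr (N _); apply/funext => z /=; rewrite mulN1r.
have := integrable_fin_num measurableT iz.
move: e; case: (\int[N]_z z%:E)%E => // v [e] _.
by congr _%:E; lra.
Qed.

Lemma integral_normal_quadratic (c0 c1 c2 : R) :
  (\int[N]_z (c0 + c1 * z + c2 * z ^+ 2)%:E = (c0 + c2)%:E)%E.
Proof.
have iz : N.-integrable setT (EFin : R -> \bar R).
  by apply: (integrable_gauss_le (C := 1) (k := 1)) => // z; rewrite mul1r expr1 lerDr.
have izz : N.-integrable setT (fun z : R => (z ^+ 2)%:E).
  apply: (integrable_gauss_le (f := fun z => z ^+ 2) (C := 1) (k := 2)) => [|z].
    exact: measurable_funX.
  by rewrite mul1r normrX lerXn2r ?nnegrE// ?lerDr// addr_ge0.
have i0 : N.-integrable setT (EFin \o cst c0) by exact: finite_measure_integrable_cst.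
have i1 := integrableZl measurableT c1 iz.
have i2 := integrableZl measurableT c2 izz.
have -> : (\int[N]_z (c0 + c1 * z + c2 * z ^+ 2)%:E =
  \int[N]_z ((c0%:E + c1%:E * z%:E) + c2%:E * (z ^+ 2)%:E))%E.
  by apply: eq_integral => z _; rewrite -!EFinM -!EFinD.
rewrite integralD//; last exact: integrableD.
rewrite integralD// !integralZl// integral_normal_id integral_normal_sqr.
have -> : (\int[N]_z c0%:E = c0%:E)%E.
  rewrite integral_cst// -[RHS]mule1; congr (_ * _)%E.
  exact: (@probability_setT _ _ _ (normal_prob 0 1 : probability _ R)).
by rewrite mule1 mule0 adde0 EFinD.
Qed.

(** The argument of q is the drifted position at time r^2. The linear Gaussian term averages to 0
    and the quadratic one has mean of order r^2, so q'' and the drift enter at the same order. *)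
Lemma gauss_expansion (q : {poly R}) (x mu : R) : 0 < x -> 0 < mu ->
  (forall y, 0 < y -> 0 <= q.[y]) ->
  exists K, 0 <= K /\ forall r, 0 < r -> r <= 1 -> exists v,
    (\int[N]_z (if 0 < x - mu * r ^+ 2 + r * z then q.[x - mu * r ^+ 2 + r * z] else 0)%R%:E
      = v%:E)%E /\
    `|v - (q.[x] + r ^+ 2 * (q^`(2).[x] / 2 - mu * q^`().[x]))| <= K * r ^+ 3.
Proof.
move=> x0 mu0 q0.
have [C1 [k1 [C10 q1]]] := poly_growth q x.
have [C2 [k2 [C20 q2]]] := poly_taylor2_bound q x.
(* C2 pays for the Taylor remainder and C1 / x^3 for the cut-off at 0. The factor w below is such
   that |u| <= r w (1 + |z|) and 1 + |u| <= w (1 + |z|). *)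
pose k := maxn k1 k2; pose C := C1 / x ^+ 3 + C2.
pose w := 2 + mu.
have C0 : 0 <= C by rewrite addr_ge0// divr_ge0// exprn_ge0// ltW.
pose K1 := C * w ^+ (3 + k).
have iM := integrableZl measurableT K1 (integrable_gauss_growth (3 + k)).
pose q2b := q^`(2).[x] / 2.
pose M := fine (\int[N]_z (K1%:E * ((1 + `|z|) ^+ (3 + k))%:E))%E.
have ME : (\int[N]_z (K1%:E * ((1 + `|z|) ^+ (3 + k))%:E) = M%:E)%E.
  by rewrite fineK// integrable_fin_num.
have K10 : 0 <= K1 by rewrite mulr_ge0// exprn_ge0// addr_ge0// ltW.
have M0 : 0 <= M.
  by rewrite fine_ge0// integral_ge0// => z _; rewrite -EFinM lee_fin mulr_ge0// exprn_ge0// addr_ge0.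
exists (M + `|q2b| * mu ^+ 2); split=> [|r r0 r1].
  by rewrite addr_ge0// mulr_ge0// sqr_ge0.
pose u (z : R) := r * z - mu * r ^+ 2.
pose f (z : R) := if 0 < x + u z then q.[x + u z] else 0.
pose c0 := q.[x] - q^`().[x] * (mu * r ^+ 2) + q2b * (mu * r ^+ 2) ^+ 2.
pose c1 := q^`().[x] * r - q2b * (r * (mu * r ^+ 2)) *+ 2.
pose A (z : R) := c0 + c1 * z + q2b * r ^+ 2 * z ^+ 2.
have AE z : A z = q.[x] + q^`().[x] * u z + q2b * u z ^+ 2.
  by rewrite /A /c0 /c1 /u; ring.
have mu_ : measurable_fun setT u.
  by apply: measurable_funB => //; exact: measurable_funM.
have mxu : measurable_fun setT (fun z => x + u z) by exact: measurable_funD.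
have mf : measurable_fun setT f.
  apply: measurable_fun_ifT => //; first exact: measurable_fun_ltr.
  by apply: (measurableT_comp (f := horner q)) => //; apply: continuous_measurable_fun; exact: continuous_horner.
have mA : measurable_fun setT A.
  by apply: measurable_funD; [apply: measurable_funD => //; exact: measurable_funM|
     apply: measurable_funM => //; exact: measurable_funX].
have uw z : `|u z| <= r * (w * (1 + `|z|)).
  apply: (le_trans (ler_normB _ _)); rewrite !normrM (gtr0_norm r0) (gtr0_norm mu0).
  rewrite (_ : _ + _ = r * (`|z| + mu * r)); last by ring.
  rewrite ler_wpM2l ?ltW//.
  have h1 : mu * r <= mu by rewrite ler_piMr// ltW.
  have h2 := mulr_ge0 (ltW mu0) (normr_ge0 z); have := normr_ge0 z.
  by rewrite /w; lra.
have uw1 z : 1 + `|u z| <= w * (1 + `|z|).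
  apply: (@le_trans _ _ (1 + (`|z| + mu))); last first.
    by have h2 := mulr_ge0 (ltW mu0) (normr_ge0 z); have := normr_ge0 z; rewrite /w; lra.
  rewrite lerD2l; apply: (le_trans (ler_normB _ _)).
  rewrite !normrM (gtr0_norm r0) (gtr0_norm mu0) lerD//; first by rewrite ler_piMl.
  by rewrite ler_piMr ?mulr_ile1 ?(ltW mu0) ?(ltW r0).
have remM z : `|f z - A z| <= r ^+ 3 * (K1 * (1 + `|z|) ^+ (3 + k)).
  have step : `|f z - A z| <= C * `|u z| ^+ 3 * (1 + `|u z|) ^+ k.
    have y1 : 1 <= 1 + `|u z| by rewrite lerDl.
    have tb : `|q.[x + u z] - A z| <= C2 * `|u z| ^+ 3 * (1 + `|u z|) ^+ k.
      rewrite AE; apply: (le_trans (q2 (u z))); rewrite ler_wpM2l//.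
        by rewrite mulr_ge0// exprn_ge0.
      by rewrite ler_weXn2l// leq_maxr.
    rewrite /f; case: ltP => xu.
      apply: le_trans tb _; rewrite -!mulrA ler_wpM2r// ?mulr_ge0 ?exprn_ge0//.
      by rewrite /C lerDr divr_ge0// exprn_ge0// ltW.
    rewrite -[X in `|X|](_ : (q.[x + u z] - A z) - q.[x + u z] = _); last by ring.
    apply: (le_trans (ler_normB _ _)); rewrite addrC /C !mulrDl lerD//.
    apply: (le_trans (q1 (u z))).
    rewrite (_ : C1 / x ^+ 3 * _ = C1 * (`|u z| / x) ^+ 3); last first.
      by rewrite exprMn exprVn; field; rewrite gt_eqF.
    (* Where the cut-off acts, x + u <= 0 gives |u| >= x, so a factor (|u| / x)^3 can be inserted
       and the loss is of order r^3. *)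
    have ux : 1 <= `|u z| / x.
      by rewrite ler_pdivlMr// mul1r ler_normr; apply/orP; right; lra.
    rewrite -mulrA ler_wpM2l//.
    apply: (@le_trans _ _ ((1 + `|u z|) ^+ k)); first by rewrite ler_weXn2l// leq_maxl.
    by rewrite ler_peMl ?exprn_ege1// exprn_ge0.
  apply: (le_trans step).
  rewrite [leRHS](_ : _ = C * (r * (w * (1 + `|z|))) ^+ 3 * (w * (1 + `|z|)) ^+ k); last first.
    by rewrite /K1 !exprMn !exprD; ring.
  rewrite ler_pM// ?mulr_ge0 ?exprn_ge0//; last by rewrite lerXn2r ?nnegrE// (le_trans _ (uw1 z)).
  by rewrite ler_wpM2l// lerXn2r ?nnegrE// (le_trans _ (uw z)).
have irM := integrableZl measurableT (r ^+ 3) iM.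
have mrem : measurable_fun setT (fun z => f z - A z) by exact: measurable_funB.
have irem : N.-integrable setT (EFin \o (fun z => f z - A z)).
  apply: le_integrable irM => //; first exact/measurable_EFinP.
  by move=> z _ /=; rewrite lee_fin (le_trans (remM z))// ler_norm.
have iA : N.-integrable setT (EFin \o A).
  apply: (integrable_gauss_le (C := `|c0| + `|c1| + `|q2b * r ^+ 2|) (k := 2)) => // z.
  have y1 : 1 <= 1 + `|z| by rewrite lerDl.
  have y0 : 0 <= 1 + `|z| by apply: le_trans y1.
  set y := 1 + `|z|; rewrite [leRHS](_ : _ =
    `|c0| * y ^+ 2 + `|c1| * y ^+ 2 + `|q2b * r ^+ 2| * y ^+ 2); last by ring.
  apply: (le_trans (ler_normD _ _)); rewrite lerD//.
    apply: (le_trans (ler_normD _ _)); rewrite lerD//.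
      by rewrite ler_peMr// exprn_ege1.
    rewrite normrM ler_wpM2l// expr2 (@le_trans _ _ (1 + `|z|))// ?lerDr// ler_peMr//.
  by rewrite normrM ler_wpM2l// normrX lerXn2r ?nnegrE// lerDr.
pose rho := fine (\int[N]_z (f z - A z)%:E)%E.
have rhoE : (\int[N]_z (f z - A z)%:E = rho%:E)%E.
  by rewrite fineK// (integrable_fin_num _ irem).
exists ((c0 + q2b * r ^+ 2) + rho); split.
  transitivity (\int[N]_z ((A z)%:E + (f z - A z)%:E))%E.
    apply: eq_integral => z _; rewrite -EFinD subrKC /f /u.
    by rewrite (_ : x + (r * z - mu * r ^+ 2) = x - mu * r ^+ 2 + r * z)//; ring.
  rewrite integralD// rhoE.
  by rewrite integral_normal_quadratic EFinD.
have rhoM : `|rho| <= r ^+ 3 * M.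
  rewrite -lee_fin -abse_EFin -rhoE.
  apply: (le_trans (le_abse_integral _ _ _)) => //; first exact/measurable_EFinP.
  rewrite EFinM -ME -integralZl//.
  apply: ge0_le_integral => //.
  - by apply: measurableT_comp => //; exact/measurable_EFinP.
  - exact: measurable_int irM.
  - by move=> z _; rewrite /= lee_fin.
(* Besides [rho] only the squared drift is left over. *)
rewrite (_ : _ - _ = rho + q2b * mu ^+ 2 * r ^+ 4); last by rewrite /c0 /q2b; ring.
apply: (le_trans (ler_normD _ _)); rewrite mulrDl lerD//; first by rewrite mulrC.
rewrite -mulrA normrM -[leRHS]mulrA ler_wpM2l//.
have r30 : 0 <= r ^+ 3 by rewrite exprn_ge0// ltW.
have r40 : 0 <= r ^+ 4 by rewrite exprn_ge0// ltW.
rewrite ger0_norm; last by apply: mulr_ge0 => //; exact: sqr_ge0.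
apply: ler_wpM2l; first exact: sqr_ge0.
by rewrite [r ^+ 4]exprSr ler_piMr.
Qed.
End GaussianExpansion.

(** * Oscillation of Brownian paths *)

Section BrownianOscillation.
Context d (T : measurableType d) (R : realType) (P : probability T R).
Variables (B : R -> {RV P >-> R}).
Hypothesis hB : standard_brownian_motion B.
Notation N := (@normal_prob R 0 1).

Lemma measurable_gt_event (f : T -> R) (c : R) : measurable_fun setT f ->
  measurable [set w | c < f w].
Proof.
move=> mf; rewrite (_ : [set w | _] = setT `&` f @^-1` `]c, +oo[); first exact: mf.
by rewrite setTI; apply/seteqP; split=> w /=; rewrite in_itv/= andbT.
Qed.

Lemma bm_integral (s t : R) (f : R -> \bar R) : 0 <= s -> s < t ->
  measurable_fun setT f -> (forall z, (0 <= f z)%E) ->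
  (\int[P]_w f (B t w - B s w)%R = \int[N]_z f (Num.sqrt (t - s) * z)%R)%E.
Proof.
move=> s0 st mf f0.
pose X := fun w : T => (B t w - B s w : measurableTypeR R).
have mX : measurable_fun setT X by exact: measurable_funB.
pose phi := fun z : measurableTypeR R => (Num.sqrt (t - s) * z : measurableTypeR R).
have mphi : measurable_fun setT phi by exact: measurable_funM.
transitivity (\int[pushforward P X]_z f z)%E.
  by rewrite ge0_integral_pushforward.
transitivity (\int[pushforward N phi]_z f z)%E; last first.
  by rewrite ge0_integral_pushforward.
apply: eq_measure_integral => // A mA _.
have r0 : Num.sqrt (t - s) != 0 by rewrite gt_eqF// sqrtr_gt0 subr_gt0.
exact: etrans (bm_gaussian_increments hB s0 st mA) (normal_probZ r0 mA).
Qed.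

Definition gauss_moment8 : R := fine (\int[N]_z ((1 + `|z|) ^+ 8)%:E)%E.

Lemma gauss_moment8_ge0 : 0 <= gauss_moment8.
Proof. by rewrite fine_ge0// integral_ge0// => z _; rewrite lee_fin exprn_ge0// addr_ge0. Qed.

(** Markov's inequality for the eighth power. The fourth power of t - s survives the union bounds
    over dyadic levels and yields the final h^4. *)
Lemma bm_increment_tail (s t c : R) : 0 <= s -> s < t -> 0 < c ->
  (P [set w | (c < `|B t w - B s w|)%R] <= ((t - s) ^+ 4 / c ^+ 8 * gauss_moment8)%:E)%E.
Proof.
move=> s0 st c0.
have mf : measurable_fun setT (fun z : R => ((z / c) ^+ 8)%:E).
  by apply/measurable_EFinP; apply: measurable_funX; exact: measurable_funM.
have f0 (z : R) : (0 <= ((z / c) ^+ 8)%:E)%E by rewrite lee_fin exprn_even_ge0.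
have mX : measurable_fun setT (fun w => B t w - B s w) by exact: measurable_funB.
have mD : measurable [set w | (c < `|B t w - B s w|)%R].
  by apply: measurable_gt_event; exact: measurableT_comp.
rewrite -[P _]mul1e -integral_cst// -[leLHS]/(\int[P]_(w in _) (cst 1%:E) w)%E.
apply: (@le_trans _ _ (\int[P]_w (((B t w - B s w) / c) ^+ 8)%:E)%E).
  rewrite integral_mkcond; apply: ge0_le_integral => //.
  - by move=> w _; rewrite patchE; case: ifP => // _; rewrite lee_fin.
  - by apply/(measurable_restrictT _ mD).
  - exact: (measurableT_comp mf mX).
  move=> w _; rewrite patchE; case: ifPn => [|_]; last exact: f0.
  rewrite inE/= => cB; rewrite lee_fin.
  rewrite -[X in _ <= X]ger0_norm ?exprn_even_ge0// normrX normrM normfV (gtr0_norm c0).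
  by rewrite exprn_ege1// ler_pdivlMr// mul1r ltW.
rewrite (bm_integral s0 st (f := fun z => ((z / c) ^+ 8)%:E))//.
have iM := integrable_gauss_growth (R := R) 8.
have ts0 : 0 <= t - s by rewrite subr_ge0 ltW.
have K0 : 0 <= (t - s) ^+ 4 / c ^+ 8.
  by rewrite divr_ge0 ?exprn_ge0// ltW.
apply: (@le_trans _ _ (\int[N]_z (((t - s) ^+ 4 / c ^+ 8)%:E * ((1 + `|z|) ^+ 8)%:E))%E).
  apply: ge0_le_integral => //.
  - apply: (measurableT_comp mf); exact: measurable_funM.
  - by apply: emeasurable_funM => //; exact: measurable_int iM.
  move=> z _; rewrite -EFinM lee_fin.
  rewrite (_ : (_ / c) ^+ 8 = (Num.sqrt (t - s) ^+ 2) ^+ 4 / c ^+ 8 * z ^+ 8); last first.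
    by set q := Num.sqrt _; field; rewrite gt_eqF.
  rewrite sqr_sqrtr// ler_wpM2l//.
  rewrite -[leLHS]ger0_norm ?exprn_even_ge0// normrX lerXn2r ?nnegrE// ?addr_ge0// lerDr//.
rewrite integralZl// -[X in (_ * X)%E]fineK ?integrable_fin_num//.
Qed.

Section Chaining.
Variables (h eta : R).
Hypotheses (h0 : 0 < h) (eta0 : 0 < eta).

Definition dyadic (k j : nat) : R := j%:R * (h / 2 ^+ k).

(* The ratio [7 / 8] is close enough to [1] that [4 (7/8)^8 >= 1]: the
   eighth-moment bounds for the [2^k] increments of level [k] then sum to
   [O(2^-k)]. *)
Definition chain_set (k j : nat) : set T :=
  [set w | eta * (7 / 8) ^+ k < `|B (dyadic k j.+1) w - B (dyadic k j) w|].

Definition chain_bad : set T := \bigcup_k \big[setU/set0]_(j < 2 ^ k) chain_set k j.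

Lemma measurable_chain_set k j : measurable (chain_set k j).
Proof.
apply: measurable_gt_event; apply: measurableT_comp => //.
exact: measurable_funB.
Qed.

Lemma measurable_chain_bad : measurable chain_bad.
Proof.
apply: bigcupT_measurable => k; apply: bigsetU_measurable => j _.
exact: measurable_chain_set.
Qed.

Lemma chain_bad_le : (P chain_bad <= (h ^+ 4 / eta ^+ 8 * gauss_moment8 * 2)%:E)%E.
Proof.
set K := h ^+ 4 / eta ^+ 8 * gauss_moment8.
have K0 : 0 <= K.
  by rewrite mulr_ge0 ?gauss_moment8_ge0// divr_ge0// exprn_ge0// ltW.
have mU k : measurable (\big[setU/set0]_(j < 2 ^ k) chain_set k j).
  by apply: bigsetU_measurable => j _; exact: measurable_chain_set.
apply: le_trans (generalized_Boole_inequality _ mU measurable_chain_bad) _.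
(* Each of the 2^k increments of level k costs at most K / 4^k, so the level costs K / 2^k and all
   levels together 2 K. *)
apply: le_trans (epsilon_trick0 xpredT (_ : 0 <= K * 2)); last by rewrite mulr_ge0.
apply: lee_nneseries => // k _.
apply: (le_trans (Boole_inequality _ _)) => [i _|]; first exact: measurable_chain_set.
apply: (@le_trans _ _ (\sum_(j < 2 ^ k) (K / ((2 : R) ^+ k * 2 ^+ k))%:E)%E).
  apply: lee_sum => j _.
  have d0 : 0 < h / 2 ^+ k by rewrite divr_gt0// exprn_gt0.
  have dd : dyadic k j.+1 - dyadic k j = h / 2 ^+ k by rewrite /dyadic -mulrBl -natrB// subSnn mul1r.
  apply: (le_trans (bm_increment_tail _ _ _)).
  - by rewrite /dyadic mulr_ge0// ltW.
  - by rewrite -subr_gt0 dd.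
  - by rewrite mulr_gt0// exprn_gt0.
  rewrite dd lee_fin.
  rewrite (_ : _ * _ = K / (2 ^+ k * 2 ^+ k) * ((2 ^+ 2 * (7 / 8) ^+ 8) ^+ k)^-1); last first.
    have -> : ((2 : R) ^+ 2 * (7 / 8) ^+ 8) ^+ k = (2 ^+ k) ^+ 2 * ((7 / 8) ^+ k) ^+ 8.
      by rewrite [(_ * _) ^+ k]exprMn exprAC [X in _ * X]exprAC.
    have a0 : (2 : R) ^+ k != 0 by rewrite gt_eqF// exprn_gt0.
    have b0 : (7 / 8 : R) ^+ k != 0 by rewrite gt_eqF// exprn_gt0.
    move: a0 b0; rewrite /K; move: (2 ^+ k) ((7 / 8) ^+ k) => a b a0 b0.
    by field; rewrite a0 b0 gt_eqF.
  rewrite ler_piMr//; first by rewrite divr_ge0// mulr_ge0// exprn_ge0.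
  by rewrite invf_le1 ?exprn_ege1 ?exprn_gt0//; lra.
rewrite sumEFin sumr_const card_ord lee_fin -[leLHS]mulr_natl !natrX exprS.
have a0 : (2 : R) ^+ k != 0 by rewrite gt_eqF// exprn_gt0.
by move: (2 ^+ k) a0 => a a0; rewrite le_eqVlt; apply/orP; left; apply/eqP; field.
Qed.

Lemma sum_chain_le (n : nat) : \sum_(i < n) eta * (7 / 8) ^+ i <= 8 * eta.
Proof.
suff -> : \sum_(i < n) eta * (7 / 8) ^+ i = 8 * eta * (1 - (7 / 8) ^+ n).
  by rewrite ler_piMr ?mulr_ge0 ?(ltW eta0)// gerBl exprn_ge0.
elim: n => [|n IH]; first by rewrite big_ord0 expr0 subrr mulr0.
by rewrite big_ord_recr/= IH exprS; lra.
Qed.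

(** Halve the index: an even point of level k + 1 already lies in level k, an odd one is a single
    increment after such a point. Each level thus adds at most one increment. *)
Lemma dyadic_chain w k j : (j <= 2 ^ k)%N -> ~ chain_bad w ->
  `|B (dyadic k j) w| <= \sum_(i < k.+1) eta * (7 / 8) ^+ i.
Proof.
move=> jk nb.
have inc i l : (l < 2 ^ i)%N -> `|B (dyadic i l.+1) w - B (dyadic i l) w| <= eta * (7 / 8) ^+ i.
  move=> li; rewrite leNgt; apply/negP => bad; apply: nb; exists i => //.
  by rewrite -bigcup_mkord; exists l.
elim: k j jk => [|k IH] j jk.
  rewrite big_ord_recl big_ord0 addr0.
  case: j jk => [|[|//]] _.
    by rewrite /dyadic mul0r (bm_start hB) normr0 mulr_ge0 ?ltW// expr0.
  have := inc 0%N 0%N isT; rewrite {2}/dyadic mul0r (bm_start hB) subr0 //.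
have half l : dyadic k.+1 l.*2 = dyadic k l.
  rewrite /dyadic exprS -muln2 natrM; field.
  by rewrite gt_eqF// exprn_gt0.
rewrite big_ord_recr/=.
have e0 : 0 <= eta * (7 / 8) ^+ k.+1 by rewrite mulr_ge0 ?exprn_ge0// ltW.
move: jk; rewrite -(odd_double_half j) expnS mul2n; case: (odd j) => /= jk.
  have lk : (j./2 < 2 ^ k)%N by rewrite -ltn_double.
  have -> : B (dyadic k.+1 (1 + j./2.*2)) w =
    B (dyadic k j./2) w + (B (dyadic k.+1 (j./2.*2).+1) w - B (dyadic k.+1 j./2.*2) w).
    by rewrite half add1n; ring.
  apply: (le_trans (ler_normD _ _)); rewrite lerD//; first by apply: IH; exact: ltnW.
  by apply: inc; rewrite expnS mul2n ltn_double.
rewrite add0n half; apply: (@le_trans _ _ (\sum_(i < k.+1) eta * (7 / 8) ^+ i)).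
  by apply: IH; rewrite add0n leq_double in jk.
by rewrite lerDl.
Qed.

(** By continuity a value above 8 eta would persist at a dyadic point close enough to t, against the
    chain bound, whose geometric series sums to 8 eta. *)
Lemma small_off_chain_bad w t : ~ chain_bad w -> 0 <= t <= h -> `|B t w| <= 8 * eta.
Proof.
move=> nb /andP[t0 th]; rewrite leNgt; apply/negP => big.
have At : `[0, +oo[%classic t by rewrite /= in_itv/= andbT.
have [|e e0 eP] := within_continuous_dist (@bm_continuous _ _ _ _ _ hB w) At (e := `|B t w| - 8 * eta).
  by rewrite subr_gt0.
pose k := Num.truncn (h / e).
have hk : h / 2 ^+ k.+1 < e.
  rewrite ltr_pdivrMr ?exprn_gt0// mulrC -ltr_pdivrMr//.
  apply: lt_le_trans (truncnS_gt _) _.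
  by rewrite -natrX ler_nat ltnW// ltn_expl.
pose c := h / 2 ^+ k.+1.
have c0 : 0 < c by rewrite divr_gt0// exprn_gt0.
pose j := Num.truncn (t / c).
have tc0 : 0 <= t / c by rewrite divr_ge0// ltW.
have /andP[j1 j2] := truncn_itv tc0.
have jk : (j <= 2 ^ k.+1)%N.
  rewrite -(ler_nat R) (le_trans j1)// ler_pdivrMr// natrX /c mulrC divfK//.
have := eP (dyadic k.+1 j); rewrite /= in_itv/= andbT.
rewrite mulr_ge0 ?(ltW c0)// => /(_ isT).
have dt : dyadic k.+1 j <= t by rewrite -ler_pdivlMr.
rewrite ler0_norm ?subr_le0// opprB ltrBlDr.
move: j2; rewrite ltr_pdivrMr// -natr1 mulrDl mul1r => j2.
have -> : t < e + dyadic k.+1 j by rewrite (lt_le_trans j2)// addrC lerD2r ltW.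
move=> /(_ isT).
have := dyadic_chain jk nb; have := sum_chain_le k.+2.
have := ler_normB (B t w) (B t w - B (dyadic k.+1 j) w).
rewrite [`|B (dyadic _ _) w - _|]distrC.
have := ler_normD (B (dyadic k.+1 j) w) (B t w - B (dyadic k.+1 j) w).
rewrite subrKC; lra.
Qed.

End Chaining.
End BrownianOscillation.

(** * The differential equation for the moments *)

Section FirstOrderExpansion.
Context {R : realType}.
Implicit Types (s y S : R) (m : nat).

(** At m = 0 the meaningless exponent [m.-1] is multiplied by 0. *)
Lemma exprD_first_order_ge s y m : 0 <= s -> 0 <= y ->
  y ^+ m + m%:R * s * y ^+ m.-1 <= (s + y) ^+ m.
Proof.
move=> s0 y0; elim: m => [|m IH]; first by rewrite !expr0 !mul0r addr0.
rewrite exprS [leRHS]exprS.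
apply: (@le_trans _ _ ((s + y) * (y ^+ m + m%:R * s * y ^+ m.-1))); last first.
  by rewrite ler_wpM2l// addr_ge0.
rewrite /= -subr_ge0 (_ : _ - _ = m%:R * s ^+ 2 * y ^+ m.-1).
  by rewrite !mulr_ge0// exprn_ge0.
case: m {IH} => [|m]; first by rewrite !expr0; ring.
by rewrite /= exprS -[m.+2%:R]natr1; ring.
Qed.

Lemma exprD_first_order_le m S : 0 <= S -> exists K, 0 <= K /\ forall s y,
  0 <= s -> s <= S -> 0 <= y ->
  (s + y) ^+ m <= y ^+ m + m%:R * s * y ^+ m.-1 + K * s ^+ 2 * (1 + y) ^+ m.
Proof.
move=> S0; elim: m => [|m [K [K0 IH]]].
  by exists 0; split=> // s y _ _ _; rewrite !expr0 !mul0r !addr0.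
exists (K * (1 + S) + m%:R); split=> [|s y s0 sS y0].
  by rewrite addr_ge0// mulr_ge0// addr_ge0.
have y1 : 0 <= 1 + y by rewrite addr_ge0.
have yM : y ^+ m.-1 <= (1 + y) ^+ m.+1.
  apply: (@le_trans _ _ ((1 + y) ^+ m.-1)); first by rewrite lerXn2r ?nnegrE// lerDr.
  by rewrite ler_weXn2l ?lerDl// (leq_trans (leq_pred _)).
rewrite exprS.
apply: (le_trans (ler_wpM2l (addr_ge0 s0 y0) (IH s y s0 sS y0))).
have -> : (s + y) * (y ^+ m + m%:R * s * y ^+ m.-1 + K * s ^+ 2 * (1 + y) ^+ m) =
  y ^+ m.+1 + m.+1%:R * s * y ^+ m + s ^+ 2 * (m%:R * y ^+ m.-1 + K * ((s + y) * (1 + y) ^+ m)).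
  case: m {IH yM} => [|m]; first by rewrite !expr0; ring.
  by rewrite /= ![y ^+ _.+1]exprS -[m.+2%:R]natr1; ring.
rewrite /= lerD2l [leRHS]mulrAC [leRHS]mulrC ler_wpM2l ?sqr_ge0//.
rewrite [leRHS]mulrDl [leLHS]addrC lerD//.
  rewrite -mulrA ler_wpM2l// exprS mulrA ler_wpM2r ?exprn_ge0//.
  have := mulr_ge0 S0 y0; lra.
by rewrite ler_wpM2l.
Qed.

(** Replaces powers of 1 + y by pure powers, whose means are moments. *)
Lemma expr1D_le y m : 0 <= y -> (1 + y) ^+ m <= 2 ^+ m * (1 + y ^+ m).
Proof.
move=> y0; have y1 : 0 <= 1 + y by rewrite addr_ge0.
have [yle|ylt] := leP y 1.
  apply: (@le_trans _ _ (2 ^+ m)); first by rewrite lerXn2r ?nnegrE//; lra.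
  by rewrite ler_peMr ?exprn_ge0// lerDl exprn_ge0.
apply: (@le_trans _ _ ((2 * y) ^+ m)).
  by rewrite lerXn2r ?nnegrE ?mulr_ge0//; lra.
by rewrite exprMn ler_wpM2l ?exprn_ge0// lerDr.
Qed.

(** First-order part of (h + t)^m (s + a)^n; the cross term of order h s is dropped, as s is of
    order h. *)
Definition first_order (m n : nat) (h s t a : R) : R :=
  t ^+ m * a ^+ n + m%:R * h * (t ^+ m.-1 * a ^+ n) + n%:R * s * (t ^+ m * a ^+ n.-1).

Lemma first_order_ge0 m n h s t a : 0 <= h -> 0 <= s -> 0 <= t -> 0 <= a ->
  0 <= first_order m n h s t a.
Proof. by move=> h0 s0 t0 a0; rewrite !addr_ge0 ?mulr_ge0// exprn_ge0. Qed.

Lemma first_order_le m n h s t a : 0 <= h -> 0 <= s -> 0 <= t -> 0 <= a ->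
  first_order m n h s t a <= (h + t) ^+ m * (s + a) ^+ n.
Proof.
move=> h0 s0 t0 a0.
have lm := exprD_first_order_ge m h0 t0; have ln := exprD_first_order_ge n s0 a0.
have t0m := exprn_ge0 m t0; have t0m1 := exprn_ge0 m.-1 t0.
have a0n := exprn_ge0 n a0; have a0n1 := exprn_ge0 n.-1 a0.
apply: (@le_trans _ _ ((t ^+ m + m%:R * h * t ^+ m.-1) * (a ^+ n + n%:R * s * a ^+ n.-1))).
  rewrite -subr_ge0 (_ : _ - _ = m%:R * h * t ^+ m.-1 * (n%:R * s * a ^+ n.-1)).
    by rewrite !mulr_ge0.
  by rewrite /first_order; ring.
by apply: ler_pM => //; rewrite addr_ge0// !mulr_ge0.
Qed.

(** The doubled exponents let one E, whose mean is a sum of moments, dominate both the expansion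
    error and the square of [first_order]; the square is needed on the exceptional event. *)
Lemma first_order_bounds m n S : 0 <= S -> exists K, 0 <= K /\
  forall h s t a, 0 <= h -> h <= 1 -> 0 <= s -> s <= h * S -> 0 <= t -> 0 <= a ->
  let E := (1 + t ^+ (2 * m)) * (1 + a ^+ (2 * n)) in
  (h + t) ^+ m * (s + a) ^+ n <= first_order m n h s t a + K * h ^+ 2 * E /\
  first_order m n h s t a ^+ 2 <= K * E.
Proof.
move=> S0.
have [K1 [K10 lK1]] := exprD_first_order_le m (ler01 : 0 <= (1 : R)).
have [K2 [K20 lK2]] := exprD_first_order_le n S0.
(* The summands pay for the dropped cross term and for the remainders of the powers of h + t and of
   s + a. K4 bounds [first_order] against (1 + t)^m (1 + a)^n, and Q comes from [expr1D_le]. *)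
pose K3 := m%:R * n%:R * S + K1 * (S + 1) ^+ n + (1 + m%:R) * K2 * S ^+ 2.
pose K4 := 1 + m%:R + n%:R * S.
have K30 : 0 <= K3 by rewrite !addr_ge0 ?mulr_ge0 ?exprn_ge0 ?addr_ge0 ?sqr_ge0.
have K40 : 0 <= K4 by rewrite !addr_ge0 ?mulr_ge0.
pose Q : R := 2 ^+ (2 * m) * 2 ^+ (2 * n).
have Q0 : 0 <= Q by rewrite mulr_ge0// exprn_ge0.
exists ((K3 + K4 ^+ 2) * Q); split; first by rewrite mulr_ge0// addr_ge0// sqr_ge0.
move=> h s t a h0 h1 s0 sS t0 a0 E.
have sS1 : s <= S by rewrite (le_trans sS)// ler_piMl.
have t1 : 1 <= 1 + t by rewrite lerDl.
have a1 : 1 <= 1 + a by rewrite lerDl.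
have t00 : 0 <= 1 + t by rewrite addr_ge0.
have a00 : 0 <= 1 + a by rewrite addr_ge0.
have tm := exprn_ge0 m t0; have tm1 := exprn_ge0 m.-1 t0.
have an := exprn_ge0 n a0; have an1 := exprn_ge0 n.-1 a0.
pose T := (1 + t) ^+ m; pose A := (1 + a) ^+ n.
have T1 : 1 <= T by rewrite exprn_ege1.
have A1 : 1 <= A by rewrite exprn_ege1.
have T0 : 0 <= T by apply: le_trans T1.
have A0 : 0 <= A by apply: le_trans A1.
have TA0 : 0 <= T * A by rewrite mulr_ge0.
have TA1 : 1 <= T * A by rewrite mulr_ege1.
have tT : t ^+ m <= T by rewrite lerXn2r ?nnegrE// lerDr.
have tT1 : t ^+ m.-1 <= T.
  apply: (@le_trans _ _ ((1 + t) ^+ m.-1)); first by rewrite lerXn2r ?nnegrE// lerDr.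
  by rewrite ler_weXn2l// leq_pred.
have aA : a ^+ n <= A by rewrite lerXn2r ?nnegrE// lerDr.
have aA1 : a ^+ n.-1 <= A.
  apply: (@le_trans _ _ ((1 + a) ^+ n.-1)); first by rewrite lerXn2r ?nnegrE// lerDr.
  by rewrite ler_weXn2l// leq_pred.
have TAE : (T * A) ^+ 2 <= Q * E.
  rewrite exprMn (_ : Q * E = (2 ^+ (2 * m) * (1 + t ^+ (2 * m))) *
    (2 ^+ (2 * n) * (1 + a ^+ (2 * n)))); last by rewrite /Q /E; ring.
  by rewrite ler_pM ?sqr_ge0// /T /A -exprM mulnC expr1D_le.
have TAQ : T * A <= Q * E by apply: le_trans TAE; rewrite expr2 ler_peMl.
have QE0 : 0 <= Q * E by apply: le_trans TAQ.
have D0 := first_order_ge0 m n h0 s0 t0 a0.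
have mh : m%:R * h * t ^+ m.-1 <= m%:R * T.
  by rewrite ler_pM ?mulr_ge0// ler_piMr.
split.
  have saA : (s + a) ^+ n <= (S + 1) ^+ n * A.
    rewrite -exprMn lerXn2r ?nnegrE ?addr_ge0 ?mulr_ge0 ?addr_ge0//.
    have := mulr_ge0 S0 a0; lra.
  apply: (@le_trans _ _ (first_order m n h s t a + h ^+ 2 * (K3 * (T * A)))); last first.
    rewrite lerD2l [leRHS]mulrAC [leRHS]mulrC ler_wpM2l ?sqr_ge0//.
    rewrite -mulrA [leRHS]mulrDl; apply: (@le_trans _ _ (K3 * (Q * E))); first by rewrite ler_wpM2l.
    by rewrite lerDl mulr_ge0// sqr_ge0.
  pose b := n%:R * s * a ^+ n.-1; pose c := m%:R * h * t ^+ m.-1.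
  have b0 : 0 <= b by rewrite !mulr_ge0.
  have c0 : 0 <= c by rewrite !mulr_ge0.
  have l1 := lK1 h t h0 h1 t0; have l2 := lK2 s a s0 sS1 a0.
  rewrite -/c -/T in l1; rewrite -/b -/A in l2.
  have sa0 : 0 <= (s + a) ^+ n by rewrite exprn_ge0// addr_ge0.
  apply: (le_trans (ler_wpM2r sa0 l1)); rewrite mulrDl.
  have h20 : 0 <= h ^+ 2 by rewrite sqr_ge0.
  have p1 : K1 * h ^+ 2 * T * (s + a) ^+ n <= h ^+ 2 * (K1 * (S + 1) ^+ n * (T * A)).
    rewrite (_ : h ^+ 2 * _ = K1 * h ^+ 2 * T * ((S + 1) ^+ n * A)); last by ring.
    by rewrite ler_wpM2l// !mulr_ge0.
  have p2 : (t ^+ m + c) * (s + a) ^+ n <=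
      (t ^+ m + c) * (a ^+ n + b) + h ^+ 2 * ((1 + m%:R) * K2 * S ^+ 2 * (T * A)).
    apply: (@le_trans _ _ ((t ^+ m + c) * (a ^+ n + b + K2 * s ^+ 2 * A))).
      by rewrite ler_wpM2l// addr_ge0.
    rewrite mulrDr lerD2l.
    rewrite (_ : h ^+ 2 * _ = ((1 + m%:R) * T) * (K2 * (h * S) ^+ 2 * A)); last by ring.
    rewrite ler_pM ?mulr_ge0 ?sqr_ge0 ?addr_ge0//; first by rewrite mulrDl mul1r lerD.
    by rewrite ler_wpM2r// ler_wpM2l// lerXn2r ?nnegrE// mulr_ge0.
  have p3 : c * b <= h ^+ 2 * (m%:R * n%:R * S * (T * A)).
    rewrite (_ : h ^+ 2 * _ = (m%:R * h * T) * (n%:R * (h * S) * A)); last by ring.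
    rewrite ler_pM// ?mulr_ge0// ?ler_wpM2l ?mulr_ge0//.
    by rewrite ler_pM ?mulr_ge0// ler_wpM2l.
  have e : (t ^+ m + c) * (a ^+ n + b) = first_order m n h s t a + c * b.
    by rewrite /first_order /b /c; ring.
  rewrite e in p2; rewrite /K3 !mulrDl !mulrDr.
  by lra.
rewrite [leRHS](_ : _ = K3 * (Q * E) + K4 ^+ 2 * (Q * E)); last by ring.
apply: (@le_trans _ _ (K4 ^+ 2 * (Q * E))); last first.
  by rewrite lerDr mulr_ge0.
apply: (@le_trans _ _ ((K4 * (T * A)) ^+ 2)); last first.
  by rewrite [leLHS]exprMn ler_wpM2l ?sqr_ge0.
rewrite lerXn2r ?nnegrE ?(mulr_ge0 K40)// /K4 !mulrDl mul1r /first_order !lerD//.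
- by rewrite ler_pM.
- rewrite -mulrA (_ : m%:R * (T * A) = m%:R * (1 * (T * A))); last by rewrite mul1r.
  by rewrite ler_wpM2l// ler_pM ?mulr_ge0// ler_pM.
- rewrite -!mulrA ler_wpM2l// ler_pM ?mulr_ge0//.
  by rewrite ler_pM.
Qed.

End FirstOrderExpansion.

Section HasMean.
Context d (T : measurableType d) (R : realType) (P : probability T R).

(** Bundling nonnegativity and measurability with a real value lets means be added, scaled and
    compared as real numbers. *)
Definition has_mean (f : T -> R) (v : R) : Prop :=
  [/\ measurable_fun setT f, (forall w, 0 <= f w) & (\int[P]_w (f w)%:E = v%:E)%E].

Lemma has_mean_add f g u v : has_mean f u -> has_mean g v ->
  has_mean (fun w => f w + g w) (u + v).
Proof.
move=> [mf f0 fu] [mg g0 gv]; split; [exact: measurable_funD|by move=> w; rewrite addr_ge0|].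
under eq_integral do rewrite EFinD.
rewrite ge0_integralD//.
- by rewrite fu gv EFinD.
- by move=> w _; rewrite lee_fin.
- exact/measurable_EFinP.
- by move=> w _; rewrite lee_fin.
- exact/measurable_EFinP.
Qed.

Lemma has_mean_scale c f u : 0 <= c -> has_mean f u -> has_mean (fun w => c * f w) (c * u).
Proof.
move=> c0 [mf f0 fu]; split; [exact: measurable_funM|by move=> w; rewrite mulr_ge0|].
under eq_integral do rewrite EFinM.
rewrite ge0_integralZl_EFin//.
- by rewrite fu EFinM.
- by move=> w _; rewrite lee_fin.
- exact/measurable_EFinP.
Qed.

Lemma has_mean_cst c : 0 <= c -> has_mean (cst c) c.
Proof.
move=> c0; split=> //.
transitivity (c%:E * P setT)%E; last by rewrite probability_setT mule1.
exact: (integral_cst P measurableT c%:E).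
Qed.

Lemma has_mean_le f g u v : has_mean f u -> has_mean g v ->
  {ae P, forall w, f w <= g w} -> u <= v.
Proof.
move=> [mf f0 fu] [mg g0 gv] fg; rewrite -lee_fin -fu -gv.
apply: ae_ge0_le_integral => //.
- by move=> w _; rewrite lee_fin.
- exact/measurable_EFinP.
- by move=> w _; rewrite lee_fin.
- exact/measurable_EFinP.
- by apply: filterS fg => w fgw _; rewrite lee_fin.
Qed.

Lemma has_mean_eq f g u : f =1 g -> has_mean f u -> has_mean g u.
Proof. by move=> /funext ->. Qed.

Lemma has_mean_indic_le (A : set T) c : measurable A -> (P A <= c%:E)%E ->
  exists v, has_mean (\1_A : T -> R) v /\ v <= c.
Proof.
move=> mA Ac; have PA : P A \is a fin_num by exact: fin_num_measure.
exists (fine (P A)); split; last by rewrite -lee_fin fineK.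
split; [exact: measurable_indic|by move=> w; rewrite indicE|].
by rewrite integral_indic// setIT fineK.
Qed.

End HasMean.

Section PathwiseSplit.
Context {R : realType}.
Notation mu := (@lebesgue_measure R).

Lemma integral_start_bounds (f : R -> R) (h lo hi : R) : 0 <= h -> 0 <= lo ->
  {within `[0, +oo[, continuous f} -> (forall t, 0 <= t <= h -> lo <= f t <= hi) ->
  ((h * lo)%:E <= \int[mu]_(t in `[0%R, h[) (f t)%:E)%E /\
  (\int[mu]_(t in `[0%R, h[) (f t)%:E <= (h * hi)%:E)%E.
Proof.
move=> h0 lo0 cf fb.
have fb' t : `[0, h[%classic t -> lo <= f t <= hi.
  by rewrite /= in_itv/= => /andP[t0 th]; apply: fb; rewrite t0 ltW.
have mf : measurable_fun `[0, h[ (fun t => (f t)%:E).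
  apply/measurable_EFinP; apply: (within_continuous_measurable cf) => // t /=.
  by rewrite !in_itv/= andbT => /andP[].
have muE c : (\int[mu]_(t in `[0%R, h[) (cst c%:E) t = (h * c)%:E)%E.
  rewrite integral_cst//= lebesgue_measure_itv/= lte_fin.
  case: ltP => [_|h1]; first by rewrite oppr0 adde0 -EFinM mulrC.
  by rewrite (_ : h = 0) ?mul0r ?mule0//; apply/eqP; rewrite eq_le h1.
rewrite -!muE; split; apply: ge0_le_integral => //.
- by move=> t /fb'/andP[+ _]; rewrite lee_fin.
- by move=> t /fb'/andP[lof _]; rewrite lee_fin (le_trans lo0).
- by move=> t /fb'/andP[_]; rewrite lee_fin.
Qed.

Lemma killed_split (f g : path_space R) (h lo hi : R) : 0 <= h -> 0 < lo ->
  (forall s, sval g s = sval f (h + s)) ->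
  (forall t, 0 <= t <= h -> lo <= sval f t <= hi) ->
  first_passage (sval f) \is a fin_num -> passage_area (sval f) \is a fin_num ->
  killed_time f = h + killed_time g /\
  exists2 I, h * lo <= I <= h * hi & killed_area f = I + killed_area g.
Proof.
move=> h0 lo0 gE fb tf af.
have fpos t : 0 <= t <= h -> 0 < sval f t by move=> /fb/andP[+ _]; exact: lt_le_trans.
have gE' : sval g = (fun s => sval f (h + s)) by exact/funext.
have f0 : 0 < sval f 0 by apply: fpos; rewrite lexx.
have g0 : 0 < sval g 0 by rewrite gE addr0 fpos// h0/=.
have [Ilo Ihi] := integral_start_bounds h0 (ltW lo0) (svalP f) fb.
have tE := first_passage_shift h0 fpos; rewrite -gE' in tE.
have aE := passage_area_shift h0 (svalP f) fpos; rewrite -gE' in aE.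
have If : (\int[mu]_(t in `[0%R, h[) (sval f t)%:E)%E \is a fin_num.
  rewrite fin_numE; apply/andP; split.
    by apply/eqP => e; move: Ilo; rewrite e.
  by apply/eqP => e; move: Ihi; rewrite e.
have ag : passage_area (sval g) \is a fin_num by move: af; rewrite aE fin_numD => /andP[].
have tg : first_passage (sval g) \is a fin_num by move: tf; rewrite tE fin_numD => /andP[].
rewrite /killed_time /killed_area !mem_set//; split; first by rewrite tE fineD.
exists (fine (\int[mu]_(t in `[0%R, h[) (sval f t)%:E)%E); last by rewrite aE fineD.
by rewrite -!lee_fin fineK// Ilo.
Qed.

End PathwiseSplit.

Section Generator.
Context d (T : measurableType d) (R : realType) (P : probability T R).
Variables (B : R -> {RV P >-> R}) (mu : R).
Hypotheses (hB : standard_brownian_motion B) (hmu : 0 < mu).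
Variable a : forall p q : nat, 'cV[R]_(p + 2 * q).
Hypothesis ha : forall p q : nat, (0 < p + q)%N -> forall x : R, 0 < x ->
  joint_moment B mu p q x = (\sum_(k < p + 2 * q) a p q k 0 * x ^+ k.+1)%:E.

Notation V p q := (moment_poly a p q).
Notation N := (@normal_prob R 0 1).

Definition generator (q : {poly R}) : {poly R} := 2^-1 *: q^`(2) - mu *: q^`().

Lemma moment_poly_ge0 p q y : (0 < p + q)%N -> 0 < y -> 0 <= (V p q).[y].
Proof.
move=> pq y0; rewrite -lee_fin -(killed_moment_from hB ha pq y0).
by apply: integral_ge0 => w _; rewrite lee_fin killed_moment_ge0.
Qed.

Lemma mean_from p q y : (0 < p + q)%N -> 0 < y ->
  has_mean P (fun w => killed_moment p q (drifted_path mu hB y w)) (V p q).[y].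
Proof.
move=> pq y0; split; last exact: killed_moment_from.
  by apply: (measurableT_comp (@measurable_killed_moment R p q)); exact: measurable_drifted_path.
by move=> w; exact: killed_moment_ge0.
Qed.

Lemma mean_after p q x : (0 < p + q)%N -> 0 < x -> exists K, 0 <= K /\
  forall r (r0 : 0 < r), r <= 1 -> exists v,
  has_mean P (fun w => killed_moment p q (shifted_path mu hB x (exprn_ge0 2 (ltW r0)) w)) v /\
  `|v - ((V p q).[x] + r ^+ 2 * (generator (V p q)).[x])| <= K * r ^+ 3.
Proof.
move=> pq x0.
have V0 y : 0 < y -> 0 <= (V p q).[y] by exact: moment_poly_ge0.
have [K [K0 KP]] := gauss_expansion x0 hmu V0.
exists K; split=> // r r0 r1; have [v [vE vK]] := KP r r0 r1.
exists v; split; last first.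
  by rewrite /generator hornerD hornerN !hornerZ [2^-1 * _]mulrC.
have h0 := exprn_gt0 2 r0.
split.
- apply: (measurableT_comp (@measurable_killed_moment R p q)).
  exact: measurable_shifted_path.
- by move=> w; exact: killed_moment_ge0.
rewrite (killed_moment_after hB ha)// -vE.
pose F (z : R) : \bar R := (if 0 < x - mu * r ^+ 2 + z
  then (V p q).[x - mu * r ^+ 2 + z] else 0)%:E.
have mF : measurable_fun setT F.
  have mz : measurable_fun setT (fun z : R => x - mu * r ^+ 2 + z) by exact: measurable_funD.
  apply/measurable_EFinP; apply: measurable_fun_ifT => //; first exact: measurable_fun_ltr.
  apply: (measurableT_comp (f := horner (V p q))) => //.
  by apply: continuous_measurable_fun; exact: continuous_horner.
have F0 z : (0 <= F z)%E by rewrite /F lee_fin; case: ifP => // /V0.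
have := bm_integral hB (lexx 0) h0 mF F0.
rewrite subr0 sqrtr_sqr gtr0_norm// => <-.
by apply: eq_integral => w _; rewrite /F (bm_start hB) subr0 /drifted.
Qed.

End Generator.

Section MomentEquation.
Context d (T : measurableType d) (R : realType) (P : probability T R).
Variables (B : R -> {RV P >-> R}) (mu : R).
Hypotheses (hB : standard_brownian_motion B) (hmu : 0 < mu).
Variable a : forall p q : nat, 'cV[R]_(p + 2 * q).
Hypothesis ha : forall p q : nat, (0 < p + q)%N -> forall x : R, 0 < x ->
  joint_moment B mu p q x = (\sum_(k < p + 2 * q) a p q k 0 * x ^+ k.+1)%:E.

Notation V p q := (moment_poly a p q).
Notation "'after' x r0" := (shifted_path mu hB x (exprn_ge0 2 (ltW r0))) (at level 10, x, r0 at level 9).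

Variables (m n : nat) (x : R).
Hypotheses (m0 : (0 < m)%N) (n0 : (0 < n)%N) (x0 : 0 < x).

(** The bound is uniform in c, so that one b serves c = x + e and c = x - e. The lower moments
    already carry a factor r^2, so only their values at x matter. *)
Lemma mean_first_order : exists b, 0 <= b /\ forall r (r0 : 0 < r), r <= 1 ->
  forall c, 0 <= c -> c <= 2 * x -> exists v,
  has_mean P (fun w => first_order m n (r ^+ 2) (r ^+ 2 * c)
      (killed_time (after x r0 w)) (killed_area (after x r0 w))) v /\
  `|v - ((V m n).[x] + r ^+ 2 * ((generator mu (V m n)).[x] +
       m%:R * (V m.-1 n).[x] + n%:R * c * (V m n.-1).[x]))| <= b * r ^+ 3.
Proof.
have mn : (0 < m + n)%N by rewrite addn_gt0 m0.
have mn1 : (0 < m.-1 + n)%N by rewrite addn_gt0 n0 orbT.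
have mn2 : (0 < m + n.-1)%N by rewrite addn_gt0 m0.
have [K1 [K10 H1]] := mean_after hB hmu ha mn x0.
have [K2 [K20 H2]] := mean_after hB hmu ha mn1 x0.
have [K3 [K30 H3]] := mean_after hB hmu ha mn2 x0.
pose b2 := `|(generator mu (V m.-1 n)).[x]| + K2.
pose b3 := `|(generator mu (V m n.-1)).[x]| + K3.
have b20 : 0 <= b2 by rewrite addr_ge0.
have b30 : 0 <= b3 by rewrite addr_ge0.
exists (K1 + m%:R * b2 + n%:R * (2 * x) * b3); split.
  by rewrite !addr_ge0 ?mulr_ge0// ltW.
move=> r r0 r1 c c0 cx.
have [v1 [M1 E1]] := H1 r r0 r1; have [v2 [M2 E2]] := H2 r r0 r1.
have [v3 [M3 E3]] := H3 r r0 r1.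
have h0 : 0 <= r ^+ 2 by rewrite sqr_ge0.
exists (v1 + m%:R * r ^+ 2 * v2 + n%:R * (r ^+ 2 * c) * v3); split.
  have A2 := has_mean_scale (mulr_ge0 (ler0n _ m) h0) M2.
  have A3 := has_mean_scale (mulr_ge0 (ler0n _ n) (mulr_ge0 h0 c0)) M3.
  by have := has_mean_add (has_mean_add M1 A2) A3; apply: has_mean_eq.
have r30 : 0 <= r ^+ 3 by rewrite exprn_ge0// ltW.
(* With the prefactor r^2 the generator term is of order r^4, hence absorbed in r^3 as r <= 1. *)
have small (v u L K : R) : 0 <= K -> `|v - (u + r ^+ 2 * L)| <= K * r ^+ 3 ->
    `|r ^+ 2 * (v - u)| <= (`|L| + K) * r ^+ 3.
  move=> K0 H; rewrite normrM (ger0_norm h0).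
  rewrite (_ : (`|L| + K) * r ^+ 3 = r ^+ 2 * (`|L| * r + K * r)); last by ring.
  rewrite ler_wpM2l//.
  rewrite (_ : v - u = (v - (u + r ^+ 2 * L)) + r ^+ 2 * L); last by ring.
  apply: (le_trans (ler_normD _ _)); rewrite addrC lerD//.
    rewrite normrM (ger0_norm h0) mulrC ler_wpM2l// expr2 ler_piMl// ltW//.
  apply: (le_trans H); rewrite ler_wpM2l// [r ^+ 3]exprSr ler_piMl ?exprn_ile1// ltW//.
have S2 := small _ _ _ _ K20 E2; have S3 := small _ _ _ _ K30 E3.
rewrite (_ : _ - _ = (v1 - ((V m n).[x] + r ^+ 2 * (generator mu (V m n)).[x])) +
  m%:R * (r ^+ 2 * (v2 - (V m.-1 n).[x])) +
  n%:R * c * (r ^+ 2 * (v3 - (V m n.-1).[x]))); last by ring.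
apply: (le_trans (ler_normD _ _)).
rewrite (_ : (K1 + _ + _) * _ = K1 * r ^+ 3 + m%:R * (b2 * r ^+ 3) +
  n%:R * (2 * x) * (b3 * r ^+ 3)); last by ring.
apply: lerD.
  apply: (le_trans (ler_normD _ _)); apply: lerD => //.
  by rewrite normrM [X in X * _]ger0_norm//; apply: ler_pM.
rewrite normrM [X in X * _]ger0_norm ?mulr_ge0//.
by apply: ler_pM => //; [rewrite mulr_ge0|rewrite ler_wpM2l].
Qed.

Lemma mean_remainder : exists b, 0 <= b /\ forall r (r0 : 0 < r), r <= 1 -> exists v,
  has_mean P (fun w => (1 + killed_time (after x r0 w) ^+ (2 * m)) *
                       (1 + killed_area (after x r0 w) ^+ (2 * n))) v /\ v <= b.
Proof.
have p1 : (0 < 2 * m + 0)%N by rewrite addn0 muln_gt0.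
have p2 : (0 < 0 + 2 * n)%N by rewrite muln_gt0.
have p3 : (0 < 2 * m + 2 * n)%N by rewrite addn_gt0 muln_gt0 m0.
have bounded p q : (0 < p + q)%N -> exists b, 0 <= b /\ forall r (r0 : 0 < r), r <= 1 ->
    exists v, has_mean P (fun w => killed_moment p q (after x r0 w)) v /\ v <= b.
  move=> pq; have [K [K0 H]] := mean_after hB hmu ha pq x0.
  exists (`|(V p q).[x]| + `|(generator mu (V p q)).[x]| + K); split.
    by rewrite !addr_ge0.
  move=> r r0 r1; have [v [M E]] := H r r0 r1; exists v; split=> //.
  have h1 : r ^+ 2 * (generator mu (V p q)).[x] <= `|(generator mu (V p q)).[x]|.
    apply: (le_trans (ler_norm _)); rewrite normrM ler_piMl//.
    by rewrite ger0_norm ?sqr_ge0// exprn_ile1// ltW.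
  have h2 : K * r ^+ 3 <= K by rewrite ler_piMr// exprn_ile1// ltW.
  have := le_trans (ler_norm _) E; have := ler_norm (V p q).[x]; lra.
have [b1 [b10 H1]] := bounded _ _ p1; have [b2 [b20 H2]] := bounded _ _ p2.
have [b3 [b30 H3]] := bounded _ _ p3.
exists (1 + b1 + b2 + b3); split; first by rewrite !addr_ge0.
move=> r r0 r1; have [v1 [M1 E1]] := H1 r r0 r1; have [v2 [M2 E2]] := H2 r r0 r1.
have [v3 [M3 E3]] := H3 r r0 r1.
exists (1 + v1 + v2 + v3); split; last by rewrite !lerD.
have := has_mean_add (has_mean_add (has_mean_add (has_mean_cst P ler01) M1) M2) M3.
by apply: has_mean_eq => w; rewrite /killed_moment !expr0 /=; ring.
Qed.

Let G := (generator mu (V m n)).[x] + m%:R * (V m.-1 n).[x] + n%:R * x * (V m n.-1).[x].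

(** Replacing the area collected up to h by h (x + e) or h (x - e) bounds the moment from above or
    below; V_{m,n}(x) cancels, and dividing by h = r^2 leaves an error of order r. *)
Lemma moment_equation_squeeze (e : R) : 0 < e -> e < x -> exists b r1, [/\ 0 <= b, 0 < r1 &
  forall r, 0 < r -> r <= r1 ->
    - (b * r) <= G + n%:R * e * (V m n.-1).[x] /\
    G - n%:R * e * (V m n.-1).[x] <= b * r].
Proof.
move=> e0 ex.
have lo0 : 0 < x - e by rewrite subr_gt0.
have hi0 : 0 < x + e by rewrite addr_gt0.
have hi2 : x + e <= 2 * x by lra.
have lo2 : x - e <= 2 * x by lra.
have near_start (u v : R) : - (8 * (e / 16)) <= v -> v <= 8 * (e / 16) -> u <= e / 2 ->
    0 <= u -> x - e <= x - u + v <= x + e.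
  by move=> v1 v2 u1 u0; apply/andP; split; lra.
(* On the exceptional event, of probability [O(h^4)], a variable with bounded
   second moment thus contributes only [O(h^2)]. *)
have amgm (h u : R) : 0 < h -> u <= h ^+ 2 * u ^+ 2 + h ^- 2.
  move=> h0; set S := h ^+ 2 * u ^+ 2 + h ^- 2.
  have S0 : 0 <= S by apply: addr_ge0; [rewrite mulr_ge0 ?sqr_ge0|rewrite invr_ge0 sqr_ge0].
  have := sqr_ge0 (h * u - h ^-1).
  rewrite (_ : (h * u - h ^-1) ^+ 2 = S - 2 * u); first by lra.
  by rewrite /S; field; rewrite gt_eqF.
have mn : (0 < m + n)%N by rewrite addn_gt0 m0.
have mn2 : (0 < 2 * m + 2 * n)%N by rewrite addn_gt0 muln_gt0 m0.
have [b1 [b10 HD]] := mean_first_order; have [b2 [b20 HE]] := mean_remainder.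
have S0 : 0 <= 2 * x by rewrite mulr_ge0// ltW.
have [K [K0 KP]] := first_order_bounds m n S0.
(* Then 8 eta = e / 2 is left to the oscillation of B; the drift takes the other half, since r <= e
   / (2 mu) below gives mu h <= mu r <= e / 2. *)
pose eta := e / 16; have eta0 : 0 < eta by rewrite divr_gt0.
pose C := 1 / eta ^+ 8 * gauss_moment8 R * 2.
have C0 : 0 <= C.
  by rewrite !mulr_ge0 ?gauss_moment8_ge0// invr_ge0 exprn_ge0// ltW.
have V20 : 0 <= (V (2 * m) (2 * n)).[x] by exact: (moment_poly_ge0 hB ha mn2 x0).
pose b := b1 + K * b2 + (V (2 * m) (2 * n)).[x] + C.
exists b, (Num.min 1 (e / (2 * mu))); split.
- by rewrite /b !addr_ge0// mulr_ge0.
- by rewrite lt_min ltr01 divr_gt0// mulr_gt0.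
move=> r r0; rewrite le_min => /andP[r1 rmu].
set h := r ^+ 2.
have h0 : 0 < h by rewrite exprn_gt0.
have h1 : h <= 1 by rewrite exprn_ile1// ltW.
have hr : h <= r by rewrite -[leRHS]expr1; apply: ler_wiXn2l => //; exact: ltW.
have muh : mu * h <= e / 2.
  apply: (@le_trans _ _ (mu * r)); first by apply: ler_wpM2l => //; exact: ltW.
  by move: rmu; rewrite ler_pdivlMr ?mulr_gt0//; lra.
have hlo : 0 <= h * (x - e) by rewrite mulr_ge0 ?ltW.
have hhi : 0 <= h * (x + e) by rewrite mulr_ge0 ?ltW.
have [vp [Mp Ep]] := HD r r0 r1 (x + e) (ltW hi0) hi2.
have [vm [Mm Em]] := HD r r0 r1 (x - e) (ltW lo0) lo2.
have [vE [ME EE]] := HE r r0 r1.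
have MU := mean_from hB ha mn x0; have MU2 := mean_from hB ha mn2 x0.
have mbad := measurable_chain_bad B h eta.
have badle : (P (chain_bad B h eta) <= (C * h ^+ 4)%:E)%E.
  apply: le_trans (chain_bad_le hB h0 eta0) _.
  by rewrite lee_fin /C le_eqVlt; apply/orP; left; apply/eqP; field; rewrite gt_eqF.
have [vN [MN EN]] := has_mean_indic_le mbad badle.
have hV0 : 0 <= h ^- 2 by rewrite invr_ge0 sqr_ge0.
have KhK : 0 <= K * h ^+ 2 by rewrite mulr_ge0// sqr_ge0.
have MKE := has_mean_scale KhK ME.
have MhN := has_mean_scale hV0 MN.
have MhU2 := has_mean_scale (sqr_ge0 h) MU2.
pose f w := drifted_path mu hB x w; pose g w := after x r0 w.
pose E w := (1 + killed_time (g w) ^+ (2 * m)) * (1 + killed_area (g w) ^+ (2 * n)).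
have E0 w : 0 <= E w.
  by rewrite mulr_ge0// addr_ge0// exprn_ge0// ?killed_time_ge0 ?killed_area_ge0.
pose Dp w := first_order m n h (h * (x + e)) (killed_time (g w)) (killed_area (g w)).
pose Dm w := first_order m n h (h * (x - e)) (killed_time (g w)) (killed_area (g w)).
have Dp0 w : 0 <= Dp w.
  by apply: first_order_ge0; rewrite ?killed_time_ge0 ?killed_area_ge0 ?(ltW h0).
have Dm0 w : 0 <= Dm w.
  by apply: first_order_ge0; rewrite ?killed_time_ge0 ?killed_area_ge0 ?(ltW h0).
have good w : ~ chain_bad B h eta w -> first_passage (sval (f w)) \is a fin_num ->
    passage_area (sval (f w)) \is a fin_num ->
    Dm w <= killed_moment m n (f w) /\ killed_moment m n (f w) <= Dp w + K * h ^+ 2 * E w.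
  move=> nb tf af.
  have fb t : 0 <= t <= h -> x - e <= sval (f w) t <= x + e.
    move=> /[dup] /andP[t0 th] /(small_off_chain_bad hB h0 eta0 nb).
    rewrite /eta ler_norml => /andP[B1 B2].
    have mt : mu * t <= e / 2 by apply: le_trans muh; rewrite ler_wpM2l// ltW.
    have mt0 : 0 <= mu * t by rewrite mulr_ge0// ltW.
    exact: near_start.
  have [tE [I /andP[Ilo Ihi] aE]] :=
    killed_split (f := f w) (g := g w) (ltW h0) lo0 (fun=> erefl) fb tf af.
  have t0 := killed_time_ge0 (g w); have a0 := killed_area_ge0 (g w).
  rewrite /killed_moment tE aE; split.
    apply: (le_trans (first_order_le m n (ltW h0) hlo t0 a0)).
    rewrite ler_wpM2l ?exprn_ge0 ?addr_ge0 ?(ltW h0)//.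
    by rewrite lerXn2r ?nnegrE ?addr_ge0// ?(le_trans hlo)// lerD2r.
  have hS : h * (x + e) <= h * (2 * x) by rewrite ler_wpM2l ?(ltW h0).
  have [up _] := KP h (h * (x + e)) _ _ (ltW h0) h1 hhi hS t0 a0.
  apply: le_trans up; rewrite ler_wpM2l ?exprn_ge0 ?addr_ge0 ?(ltW h0)//.
  by rewrite lerXn2r ?nnegrE ?addr_ge0// ?(le_trans hlo)// lerD2r.
have U0 w := killed_moment_ge0 m n (f w).
have UU w : killed_moment (2 * m) (2 * n) (f w) = killed_moment m n (f w) ^+ 2.
  by rewrite /killed_moment exprMn -!exprM ![(2 * _)%N]mulnC.
have N0 w : 0 <= h ^- 2 * \1_(chain_bad B h eta) w by rewrite mulr_ge0// indicE.
(* The last two terms cover the exceptional event through [amgm] and are nonnegative elsewhere. *)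
have upper := has_mean_le MU (has_mean_add (has_mean_add (has_mean_add Mp MKE) MhU2) MhN) _.
have {upper} upper : (V m n).[x] <= vp + K * h ^+ 2 * vE + h ^+ 2 * (V (2 * m) (2 * n)).[x]
    + h ^- 2 * vN.
  apply: upper.
  have := drifted_area_finite hB ha x0; have := drifted_passage_finite hB ha x0.
  apply: filterS2 => w tf af.
  rewrite -/(f w) -/(g w) -/(E w) -/(Dp w) UU.
  have [bad|nb] := pselect (chain_bad B h eta w).
    have := amgm h (killed_moment m n (f w)) h0; rewrite indicE mem_set// mulr1.
    have := mulr_ge0 KhK (E0 w); have := Dp0 w; lra.
  have [_ up] := good w nb tf af.
  have := N0 w; have := mulr_ge0 (sqr_ge0 h) (sqr_ge0 (killed_moment m n (f w))); lra.
(* On the exceptional event h^2 Dm^2 is at most K h^2 E by the second bound of [first_order_bounds],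
   so no further moment is needed. *)
have lower := has_mean_le Mm (has_mean_add (has_mean_add MU MKE) MhN) _.
have {lower} lower : vm <= (V m n).[x] + K * h ^+ 2 * vE + h ^- 2 * vN.
  apply: lower.
  have := drifted_area_finite hB ha x0; have := drifted_passage_finite hB ha x0.
  apply: filterS2 => w tf af.
  rewrite -/(f w) -/(g w) -/(E w) -/(Dm w).
  have [bad|nb] := pselect (chain_bad B h eta w).
    have hS : h * (x - e) <= h * (2 * x) by rewrite ler_wpM2l ?(ltW h0).
    have [_ D2] := KP h (h * (x - e)) _ _ (ltW h0) h1 hlo hS (killed_time_ge0 (g w))
      (killed_area_ge0 (g w)).
    have := amgm h (Dm w) h0; rewrite indicE mem_set// mulr1.
    have := ler_wpM2l (sqr_ge0 h) D2; rewrite -/(Dm w) -/(E w).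
    have := U0 w; lra.
  have [lo _] := good w nb tf af.
  have := N0 w; have := mulr_ge0 KhK (E0 w); lra.
have r3 : 0 <= r ^+ 3 by rewrite exprn_ge0// ltW.
have h2r : h ^+ 2 <= r ^+ 3 by rewrite /h -exprM ler_wiXn2l// ltW.
have t1 : K * h ^+ 2 * vE <= K * b2 * r ^+ 3.
  apply: (@le_trans _ _ (K * h ^+ 2 * b2)); first by rewrite ler_wpM2l.
  by rewrite mulrAC ler_wpM2l// mulr_ge0.
have t2 : h ^+ 2 * (V (2 * m) (2 * n)).[x] <= (V (2 * m) (2 * n)).[x] * r ^+ 3.
  by rewrite mulrC ler_wpM2l.
have t3 : h ^- 2 * vN <= C * r ^+ 3.
  apply: (@le_trans _ _ (C * h ^+ 2)); last by rewrite ler_wpM2l.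
  apply: (le_trans (ler_wpM2l hV0 EN)).
  by rewrite le_eqVlt; apply/orP; left; apply/eqP; field; rewrite gt_eqF.
have conv (q : R) : - (b * r ^+ 3) <= r ^+ 2 * q -> - (b * r) <= q.
  move=> hq; rewrite -(ler_pM2l h0) (le_trans _ hq)// /h.
  by rewrite le_eqVlt; apply/orP; left; apply/eqP; ring.
move: Ep Em; rewrite !ler_norml => /andP[_ Ep] /andP[Em _].
have bE : b * r ^+ 3 = b1 * r ^+ 3 + K * b2 * r ^+ 3 + (V (2 * m) (2 * n)).[x] * r ^+ 3
   + C * r ^+ 3 by rewrite /b; ring.
have v3 : 0 <= (V (2 * m) (2 * n)).[x] * r ^+ 3 by rewrite mulr_ge0.
split.
  apply: conv; rewrite bE.
  rewrite (_ : G + _ = (generator mu (V m n)).[x] + m%:R * (V m.-1 n).[x] +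
    n%:R * (x + e) * (V m n.-1).[x]); last by rewrite /G; ring.
  lra.
rewrite -lerN2; apply: conv; rewrite bE.
rewrite (_ : - (G - _) = - ((generator mu (V m n)).[x] + m%:R * (V m.-1 n).[x] +
  n%:R * (x - e) * (V m n.-1).[x])); last by rewrite /G; ring.
lra.
Qed.

Lemma moment_equation : G = 0.
Proof.
have W0 : 0 <= `|(V m n.-1).[x]| by [].
set W := (V m n.-1).[x] in W0 *.
(* The limit in r is taken at fixed e because b blows up as e tends to 0. *)
have key (e : R) : 0 < e -> e < x -> `|G| <= n%:R * e * `|W|.
  move=> e0 ex; have [b [r1 [b0 r10 H]]] := moment_equation_squeeze e0 ex.
  apply/ler_addgt0Pr => eps eps0.
  pose r := Num.min r1 (eps / (b + 1)).
  have b1 : 0 < b + 1 by rewrite ltr_wpDl.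
  have r0 : 0 < r by rewrite lt_min r10 divr_gt0.
  have rr1 : r <= r1 by rewrite ge_min lexx.
  have br : b * r <= eps.
    have : r <= eps / (b + 1) by rewrite ge_min lexx orbT.
    by rewrite ler_pdivlMr// mulrDr mulr1 mulrC; lra.
  have [l1 l2] := H r r0 rr1; rewrite -/W in l1 l2.
  have ne0 : 0 <= n%:R * e by rewrite mulr_ge0// ltW.
  have q1 := ler_wpM2l ne0 (ler_norm W); have := ler_wpM2l ne0 (ler_norm (- W)).
  rewrite normrN mulrN => q2; rewrite ler_norml; apply/andP; split; lra.
apply/eqP; rewrite -normr_eq0 eq_le normr_ge0 andbT; apply/ler_addgt0Pr => eps eps0.
pose q := n%:R * `|W|; have q0 : 0 <= q by rewrite mulr_ge0.
pose e := Num.min (x / 2) (eps / (q + 1)).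
have q1 : 0 < q + 1 by rewrite ltr_wpDl.
have e0 : 0 < e by rewrite lt_min !divr_gt0.
have hx : x / 2 < x by move: x0; lra.
have ex : e < x by apply: le_lt_trans hx; rewrite ge_min lexx.
apply: (le_trans (key e e0 ex)); rewrite add0r mulrAC -/q.
have : e <= eps / (q + 1) by rewrite ge_min lexx orbT.
by rewrite ler_pdivlMr// mulrDr mulr1 mulrC; lra.
Qed.

End MomentEquation.

(** * Solving the coefficient recursion *)

Section CoefficientRecursion.
Context {F : realFieldType}.
Implicit Types (mu : F) (p q : {poly F}).

Lemma poly_eq0_of_pos p : (forall x, 0 < x -> p.[x] = 0) -> p = 0.
Proof.
move=> p0; apply/eqP/negPn/negP => pn0.
(* The roots 1, ..., [size p] are one too many. *)
have := max_poly_roots pn0 (rs := [seq k.+1%:R | k <- iota 0 (size p)]).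
rewrite size_map size_iota ltnn => H; apply/notF/H.
  by apply/allP => _ /mapP[k _ ->]; rewrite rootE p0.
by rewrite map_inj_uniq ?iota_uniq// => i j /eqP; rewrite eqr_nat => /eqP[].
Qed.

(* The contribution of [q`_j] to [p`_i.+1] when [p''/2 - mu p' + q = 0]; it is
   the entry in row [i + 1], column [j + 1] of [D / m] and [E / n]. *)
Definition back_weight mu (i j : nat) : F :=
  if i == j then (i.+1%:R * mu)^-1
  else if (i < j)%N then
    (\prod_(i.+2 <= l < j.+1) l%:R) / (2 ^+ (j - i) * mu ^+ (j - i + 1))
  else 0.

Lemma back_weightS mu i j : mu != 0 ->
  back_weight mu i j = (i.+1%:R * mu)^-1 * (i == j)%:R +
                       i.+2%:R / (2 * mu) * back_weight mu i.+1 j.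
Proof.
move=> mu0; rewrite /back_weight.
case: (ltngtP i j) => [ij|ji|<-]; last by rewrite gtn_eqF// ltnNge leqnSn /= mulr1 mulr0 addr0.
  rewrite mulr0 add0r.
  have [<-|i1j] := eqVneq i.+1 j.
    rewrite big_geq// subSnn expr1 addn1 /=.
    by field; rewrite mu0 -natrD pnatr_eq0.
  have i1j' : (i.+1 < j)%N by lia.
  rewrite i1j' big_ltn// (_ : (j - i = (j - i.+1).+1)%N); last by lia.
  rewrite addSn !exprS.
  by field; rewrite mu0 !expf_neq0// pnatr_eq0.
have ji1 := ltnW ji; rewrite gtn_eqF ?ltnS// (ltnNge i.+1) (leqW ji1) /=.
by rewrite !mulr0 addr0.
Qed.

(* The coefficients of [p] are determined from the top degree downwards: the
   coefficient of [x^i] in the equation expresses [p`_i.+1] through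
   [p`_i.+2] and [q`_i]. *)
Lemma coef_generator_solution mu p q N i : mu != 0 -> (size q <= N)%N ->
  2^-1 *: p^`(2) - mu *: p^`() + q = 0 ->
  p`_i.+1 = \sum_(j < N) back_weight mu i j * q`_j.
Proof.
move=> mu0 qN eqn.
have step k : p`_k.+1 = (k.+1%:R * mu)^-1 * q`_k + k.+2%:R / (2 * mu) * p`_k.+2.
  have e : (2^-1 *: p^`()^`() - mu *: p^`() + q)`_k = 0.
    by rewrite -[RHS](coef0 F k) -eqn.
  rewrite coefD coefB !coefZ !coef_deriv in e.
  have k0 : k.+1%:R != 0 :> F by rewrite pnatr_eq0.
  have -> : q`_k = mu * (p`_k.+1 * k.+1%:R) - 2^-1 * (p`_k.+2 * k.+2%:R * k.+1%:R).
    by move/eqP: e; rewrite addrC addr_eq0 => /eqP ->; ring.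
  by field; rewrite mu0 nat1r.
(* Downward induction on i; from N + size p on both sides vanish. *)
have [M] := ubnP (N + size p - i)%N; elim: M i => // M IH i iM.
have [iN|iN] := leqP (N + size p)%N i.
  rewrite nth_default; last by rewrite (leq_trans (leq_addl N _))// (leq_trans iN).
  rewrite big1// => j _; have ji : (j < i)%N by rewrite (leq_trans (ltn_ord j))// (leq_trans _ iN)// leq_addr.
  by rewrite /back_weight gtn_eqF// ltnNge ltnW ?mul0r.
rewrite step IH; last by lia.
under [RHS]eq_bigr do rewrite back_weightS// mulrDl -!mulrA [X in _ + X]mulrA.
rewrite big_split/= -!mulr_sumr; congr (_ * _ + _).
have [iN'|iN'] := ltnP i N.
  rewrite (bigD1 (Ordinal iN'))//= eqxx mul1r big1 ?addr0// => j.
  by rewrite -val_eqE/= eq_sym => /negbTE ->; rewrite mul0r.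
rewrite nth_default ?(leq_trans qN)// big1// => j _.
by rewrite gtn_eqF ?mul0r// (leq_trans (ltn_ord j)).
Qed.

End CoefficientRecursion.

Section RecursionMatrixEntries.
Context {R : realType}.
Implicit Types (mu : R).

(** The superdiagonal case is the general formula with an empty product. *)
Lemma recursion_entryE (k : nat) mu i j :
  (if i.+1 == j.+1 then k%:R / (i.+1%:R * mu)
   else if j.+1 == i.+2 then k%:R / (2 * mu ^+ 2)
   else if (i.+2 < j.+1)%N then
     k%:R * ((\prod_(i.+2 <= l < j.+1) l%:R) / (2 ^+ (j.+1 - i.+1) * mu ^+ (j.+1 - i.+1 + 1)))
   else 0) = k%:R * back_weight mu i j.
Proof.
rewrite /back_weight !eqSS subSS ltnS; case: (ltngtP i j) => [ij|ji|//].
  have [->|ji] := eqVneq j i.+1; first by rewrite big_geq// subSnn expr1 mul1r.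
  by rewrite ltn_neqAle eq_sym ji ij.
by rewrite ltn_eqF ?(leqW ji)// [(i.+1 < j)%N]ltnNge (leqW (ltnW ji)) mulr0.
Qed.

Lemma DmxE N m mu (r c : 'I_N) :
  Dmx N m mu r c = if c == 0%N :> nat then 0 else m%:R * back_weight mu r c.
Proof. by rewrite mxE /= eqSS recursion_entryE. Qed.

Lemma EmxE N n mu (r c : 'I_N) :
  Emx N n mu r c = if (c < 2)%N then 0 else n%:R * back_weight mu r c.
Proof. by rewrite mxE /= !eqSS recursion_entryE; case: (c : nat) => [|[]]. Qed.

Lemma pad_topE q k N (e : (q + k)%N = N) (v : 'cV[R]_k) (f : nat -> R) (c : 'I_N) :
  (forall i, (i < q)%N -> f i = 0) -> (forall i : 'I_k, f (q + i)%N = v i 0) ->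
  pad_top e v c 0 = f c.
Proof.
move: c; case: N / e => c f0 fv; rewrite /pad_top castmx_id.
by case: (split_ordP c) => i ->; rewrite ?col_mxEu ?col_mxEd ?mxE/= ?fv ?f0.
Qed.

End RecursionMatrixEntries.

Section MomentCoefficients.
Context {R : realType} (a : forall p q : nat, 'cV[R]_(p + 2 * q)).

Lemma coef_moment_poly p q (i : 'I_(p + 2 * q)) : (moment_poly a p q)`_i.+1 = a p q i 0.
Proof.
rewrite coef_sum (bigD1 i)//= coefZ coefXn eqxx mulr1 big1 ?addr0// => k ki.
by rewrite coefZ coefXn eqSS eq_sym val_eqE (negbTE ki) mulr0.
Qed.

Lemma coef0_moment_poly p q : (moment_poly a p q)`_0 = 0.
Proof. by rewrite coef_sum big1// => k _; rewrite coefZ coefXn mulr0. Qed.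

Lemma size_moment_poly p q : (size (moment_poly a p q) <= (p + 2 * q).+1)%N.
Proof.
apply/leq_sizeP => j ij; rewrite coef_sum big1// => k _.
by rewrite coefZ coefXn gtn_eqF ?mulr0// (leq_trans _ ij)// ltnS ltn_ord.
Qed.

End MomentCoefficients.

Theorem mainTheorem6 (R : realType) (d : measure_display)
    (T : measurableType d) (P : probability T R) (B : R -> {RV P >-> R})
    (hB : standard_brownian_motion B) (mu : R) (hmu : 0 < mu)
    (a : forall p q : nat, 'cV[R]_(p + 2 * q))
    (ha : forall p q : nat, (0 < p + q)%N -> forall x : R, 0 < x ->
       joint_moment B mu p q x
         = (\sum_(k < p + 2 * q) a p q k 0 * x ^+ k.+1)%:E)
    (m n : nat) (hm : (1 <= m)%N) (hn : (1 <= n)%N) :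
  a m n = Dmx (m + 2 * n) m mu *m pad_top (dim_pad1 n hm) (a m.-1 n)
        + Emx (m + 2 * n) n mu *m pad_top (dim_pad2 m hn) (a m n.-1).
Proof.
pose V p q := moment_poly a p q.
(* Coefficient vectors start at degree 1. One leading zero restores the constant term, so the padded
   vector lists the coefficients of V_{m-1,n}; two zeros list those of 'X times V_{m,n-1}. *)
pose q := m%:R *: V m.-1 n + n%:R *: ('X * V m n.-1).
have eqn : generator mu (V m n) + q = 0.
  apply: poly_eq0_of_pos => x x0; rewrite -(moment_equation hB hmu ha hm hn x0) /q.
  by rewrite !(hornerD, hornerZ, hornerM, hornerX) /V; ring.
have qN : (size q <= m + 2 * n)%N.
  rewrite (leq_trans (size_polyD _ _))// geq_max; apply/andP; split.
    rewrite (leq_trans (size_scale_leq _ _))// (leq_trans (size_moment_poly _ _ _))//; lia.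
  rewrite (leq_trans (size_scale_leq _ _))// (leq_trans (size_polyMleq _ _))// size_polyX.
  by have := size_moment_poly a m n.-1; rewrite /V; lia.
apply/colP => r; rewrite -coef_moment_poly.
rewrite (coef_generator_solution _ (lt0r_neq0 hmu) qN eqn) !mxE -big_split /=.
apply: eq_bigr => c _; rewrite coefD !coefZ DmxE EmxE.
rewrite (@pad_topE _ _ _ _ _ _ (fun i => (V m.-1 n)`_i)); first last.
- by move=> i; rewrite add1n coef_moment_poly.
- by case=> // _; rewrite coef0_moment_poly.
rewrite (@pad_topE _ _ _ _ _ _ (fun i => ('X * V m n.-1)`_i)); first last.
- by move=> i; rewrite coefXM add2n coef_moment_poly.
- by case=> [|[|//]] _; rewrite coefXM// coef0_moment_poly.
(* The zero columns of [Dmx] and [Emx] meet coefficients that vanish, so replacing [back_weight] by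
   0 there changes nothing. *)
rewrite coefXM; case: (c : nat) => [|[|k]] /=; rewrite ?coef0_moment_poly; ring.
Qed.
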